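(* Let $f\colon X\to Y$ be a cocartesian fibration of Segal spaces. Then the map $$f/\Delta^0\colon X/\Delta^0\to Y/\Delta^0$$ is a cocartesian fibration of quasicategories, and if a morphism in $X_1$ is $f$-cocartesian, then it is $f/\Delta^0$-cocartesian.
   Context: A bisimplicial set is a functor $X\colon(\Delta^{op})^2\to\mathrm{Set}$, with sets $X_{mn}$; $X_m=X_{m\bullet}$ denotes the $m$th column. For simplicial sets $A,B$ put $(A\square B)_{mn}=A_m\times B_n$. For a simplicial set $A$, $A\backslash X$ and $X/A$ are the simplicial sets $(A\backslash X)_n=\mathrm{Hom}(A\square\Delta^n,X)$ and $(X/A)_n=\mathrm{Hom}(\Delta^n\square A,X)$. So $\Delta^m\backslash X=X_m$, and $X/\Delta^0$ is the zeroth row $X_{\bullet 0}$. A map $f\colon X\to Y$ is a Reedy fibration if for each monomorphism $u\colon A\to A'$ of simplicial sets the map $\langle u\backslash f\rangle\colon A'\backslash X\to A\backslash X\times_{A\backslash Y}A'\backslash Y$ is a Kan fibration. A Segal space is a Reedy fibrant bisimplicial set $X$ such that for all $n\ge2$ the map $\Delta^n\backslash X\to I_n\backslash X$ is a weak homotopy equivalence, where $I_n\subseteq\Delta^n$ is the spine (the union of the edges $\Delta^{\{i,i+1\}}$). A morphism of $X$ is an element $e\in X_{10}$. For $A\subseteq\Delta^n$ a simplicial subset containing $\Delta^{\{0,1\}}$ and $e\in X_{10}$, put $(A\backslash X)^e=A\backslash X\times_{\Delta^{\{0,1\}}\backslash X}\{e\}$. For a Reedy fibration $f\colon X\to Y$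 between Segal spaces, $e\in X_{10}$ is $f$-cocartesian if the square formed by $(\Delta^2\backslash X)^e\to(\Lambda^2_0\backslash X)^e$ (top), $(\Delta^2\backslash Y)^{f(e)}\to(\Lambda^2_0\backslash Y)^{f(e)}$ (bottom) and the vertical maps induced by $f$ is homotopy pullback (in the Kan model structure). A cocartesian fibration of Segal spaces is a Reedy fibration $f\colon X\to Y$ between Segal spaces such that for each morphism $e\colon y\to y'$ in $Y$ and each vertex $x$ of $X$ with $f(x)=y$ there is an $f$-cocartesian morphism $\tilde e\colon x\to x'$ with $f(\tilde e)=e$. *)

(* Defs.v *)
(* MathComp, with functional extensionality and proof irrelevance taken from
   mathcomp.classical.boolp. *)
From Stdlib Require Import Relation_Operators.
From mathcomp Require Import all_boot.
From mathcomp Require Import boolp.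

Set Implicit Arguments.
Unset Strict Implicit.
Unset Printing Implicit Defensive.
#[local] Obligation Tactic := idtac.

(* Monotone maps [m] -> [n], where [m] = {0,...,m} is 'I_m.+1. *)
Record dmap (m n : nat) := Dmap {
  dfun :> 'I_m.+1 -> 'I_n.+1;
  dmono : forall i j : 'I_m.+1, i <= j -> dfun i <= dfun j }.

Lemma dmap_ext m n (a b : dmap m n) : (forall i, a i = b i) -> a = b.
Proof.
case: a b => [f hf] [g hg] /= /funext E; rewrite -{}E in hg *.
by congr Dmap; apply: Prop_irrelevance.
Qed.

Definition did n : dmap n n := @Dmap n n (fun i => i) (fun _ _ h => h).

Definition dcomp m n p (b : dmap n p) (a : dmap m n) : dmap m p :=
  @Dmap m p (fun i => b (a i)) (fun i j h => dmono b (dmono a h)).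

Definition dconst m n (k : 'I_n.+1) : dmap m n :=
  @Dmap m n (fun _ => k) (fun _ _ _ => leqnn k).

(* The inclusion [1] -> [n.+1] with image {0,1}, i.e. the edge Delta^{0,1}. *)
Definition d01 n : dmap 1 n.+1 :=
  @Dmap 1 n.+1 (widen_ord (isT : 2 <= n.+2)) (fun _ _ h => h).

Record sSet := SSet {
  sob :> nat -> Type;
  sact : forall m n, dmap m n -> sob n -> sob m;
  sact_id : forall n (x : sob n), sact (did n) x = x;
  sact_comp : forall m n p (b : dmap n p) (a : dmap m n) (x : sob p),
    sact (dcomp b a) x = sact a (sact b x) }.

Record smap (A B : sSet) := SMap {
  sfun :> forall n, A n -> B n;
  snat : forall m n (a : dmap m n) (x : A n),
    sfun (sact a x) = sact a (sfun x) }.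

Lemma smap_ext (A B : sSet) (f g : smap A B) :
  (forall n x, f n x = g n x) -> f = g.
Proof.
case: f g => [f hf] [g hg] /= E.
have {}E : f = g by apply: functional_extensionality_dep => n; apply/funext/E.
by rewrite -{}E in hg *; congr SMap; apply: Prop_irrelevance.
Qed.

Definition sid (A : sSet) : smap A A :=
  @SMap A A (fun _ x => x) (fun _ _ _ _ => erefl).

Program Definition scomp (A B C : sSet) (g : smap B C) (f : smap A B) :
  smap A C := @SMap A C (fun n x => g n (f n x)) _.
Next Obligation. by move=> A B C g f m n a x /=; rewrite !snat. Qed.

Definition smono (A B : sSet) (f : smap A B) : Prop :=
  forall n, injective (f n).

Program Definition Delta (n : nat) : sSet :=
  @SSet (fun m => dmap m n) (fun m p a x => dcomp x a) _ _.
Next Obligation. by move=> n m x /=; apply: dmap_ext. Qed.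
Next Obligation. by move=> n m p q b a x /=; apply: dmap_ext. Qed.

Program Definition Deltamap m n (a : dmap m n) : smap (Delta m) (Delta n) :=
  @SMap (Delta m) (Delta n) (fun _ x => dcomp a x) _.
Next Obligation. by move=> m n a p q b x /=; apply: dmap_ext. Qed.

(* The map Delta^n -> A classifying an n-simplex of A. *)
Program Definition yo (A : sSet) n (x : A n) : smap (Delta n) A :=
  @SMap (Delta n) A (fun _ a => sact a x) _.
Next Obligation. by move=> A n x m p a b /=; rewrite -sact_comp. Qed.

Record ssub (A : sSet) := SSub {
  smem : forall n, A n -> Prop;
  smem_act : forall m n (a : dmap m n) (x : A n), smem x -> smem (sact a x) }.

Program Definition sset_of (A : sSet) (P : ssub A) : sSet :=
  @SSet (fun n => {x : A n | smem P x})
    (fun m n a x => exist _ (sact a (sval x)) _) _ _.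
Next Obligation. by move=> A P m n a [x hx] /=; apply: smem_act. Qed.
Next Obligation. by move=> A P n [x hx] /=; apply: eq_exist; apply: sact_id. Qed.
Next Obligation.
by move=> A P m n p b a [x hx] /=; apply: eq_exist; apply: sact_comp.
Qed.
Coercion sset_of : ssub >-> sSet.

Definition sincl (A : sSet) (P : ssub A) : smap P A :=
  @SMap P A (fun _ x => sval x) (fun _ _ _ _ => erefl).

Program Definition horn n (k : 'I_n.+1) : ssub (Delta n) :=
  @SSub (Delta n) (fun m a => exists2 i, i <> k & forall j, a j <> i) _.
Next Obligation.
by move=> n k m p a x [i ik hi] /=; exists i => // j; apply: hi.
Qed.

(* The spine: the union of the edges with vertices i, i+1, for i < n. *)
Program Definition spine n : ssub (Delta n) :=
  @SSub (Delta n)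
    (fun m a => exists i : 'I_n, forall j, a j = i :> nat \/ a j = i.+1 :> nat) _.
Next Obligation. by move=> n m p a x [i hi] /=; exists i => j; apply: hi. Qed.

Program Definition sprod (A B : sSet) : sSet :=
  @SSet (fun n => (A n * B n)%type)
    (fun m n a x => (sact a x.1, sact a x.2)) _ _.
Next Obligation. by move=> A B n [x y] /=; rewrite !sact_id. Qed.
Next Obligation. by move=> A B m n p b a [x y] /=; rewrite !sact_comp. Qed.

Section Pullback.
Variables (A B C : sSet) (f : smap A C) (g : smap B C).

Program Definition pb_sub : ssub (sprod A B) :=
  @SSub (sprod A B) (fun n x => f n x.1 = g n x.2) _.
Next Obligation. by move=> m n a [x y] /= E; rewrite !snat E. Qed.

(* The fibre product A x_C B. *)
Definition pb : sSet := pb_sub.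

Definition pb_fst : smap pb A :=
  @SMap pb A (fun _ x => (sval x).1) (fun _ _ _ _ => erefl).
Definition pb_snd : smap pb B :=
  @SMap pb B (fun _ x => (sval x).2) (fun _ _ _ _ => erefl).

Lemma pb_comm n (x : pb n) : f n (pb_fst n x) = g n (pb_snd n x).
Proof. by case: x. Qed.

Program Definition pb_pair (T : sSet) (p : smap T A) (q : smap T B)
    (h : forall n t, f n (p n t) = g n (q n t)) : smap T pb :=
  @SMap T pb (fun n t => exist _ (p n t, q n t) (h n t)) _.
Next Obligation.
by move=> T p q h m n a t /=; apply: eq_exist; rewrite /= !snat.
Qed.

End Pullback.

(* i has the left lifting property against p. *)
Definition lifts (A B X Y : sSet) (i : smap A B) (p : smap X Y) : Prop :=
  forall (u : smap A X) (v : smap B Y), scomp p u = scomp v i ->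
  exists2 w : smap B X, scomp w i = u & scomp p w = v.

Definition kan_fibration (X Y : sSet) (p : smap X Y) : Prop :=
  forall n (k : 'I_n.+1), 0 < n -> lifts (sincl (horn k)) p.

Program Definition to_pt (A : sSet) : smap A (Delta 0) :=
  @SMap A (Delta 0) (fun _ _ => dconst _ ord0) _.
Next Obligation. by move=> A m n a x /=; apply: dmap_ext. Qed.

Definition kan_complex (K : sSet) : Prop := kan_fibration (to_pt K).

(* An edge of the mapping space from A to K. *)
Definition elem_homotopy (A K : sSet) (g h : smap A K) : Prop :=
  exists H : smap (sprod A (Delta 1)) K, forall n (x : A n),
    H n (x, dconst n ord0) = g n x /\ H n (x, dconst n ord_max) = h n x.

(* The equivalence relation whose quotient is pi_0 of the mapping space. *)
Definition homotopic (A K : sSet) : smap A K -> smap A K -> Prop :=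
  clos_refl_sym_trans _ (@elem_homotopy A K).

(* For every Kan complex K, precomposition with f induces a bijection
   pi_0 Map(B, K) -> pi_0 Map(A, K). *)
Definition weq (A B : sSet) (f : smap A B) : Prop :=
  forall K : sSet, kan_complex K ->
    (forall g h : smap B K,
       homotopic (scomp g f) (scomp h f) -> homotopic g h) /\
    (forall g : smap A K, exists h : smap B K, homotopic (scomp h f) g).

Section HomotopyPullback.
Variables (W X Y Z : sSet).
Variables (t : smap W Y) (l : smap W X) (g : smap Y Z) (b : smap X Z).

Lemma factor_comm (Y' : sSet) (i : smap Y Y') (q : smap Y' Z) :
  scomp g t = scomp b l -> scomp q i = g ->
  forall n w, b n (l n w) = q n (scomp i t n w).
Proof.
move=> E F n w; have /(congr1 (fun h : smap W Z => h n w)) /= <- := E.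
by rewrite -F.
Qed.

(* The commutative square
       W --t--> Y
      l|        |g
       X --b--> Z
   is a homotopy pullback: for every factorization of g as a trivial
   cofibration i : Y -> Y' followed by a Kan fibration q : Y' -> Z, the induced
   map W -> X x_Z Y' is a weak homotopy equivalence (Goerss-Jardine, II.8). *)
Definition homotopy_pullback (E : scomp g t = scomp b l) : Prop :=
  forall (Y' : sSet) (i : smap Y Y') (q : smap Y' Z) (F : scomp q i = g),
    smono i -> weq i -> kan_fibration q ->
    weq (pb_pair (factor_comm E F)).

End HomotopyPullback.

Record bsSet := BSSet {
  bob :> nat -> nat -> Type;
  bact : forall m m' n n', dmap m m' -> dmap n n' -> bob m' n' -> bob m n;
  bact_id : forall m n (x : bob m n), bact (did m) (did n) x = x;
  bact_comp : forall m m' m'' n n' n''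
    (b : dmap m' m'') (a : dmap m m') (d : dmap n' n'') (c : dmap n n')
    (x : bob m'' n''),
    bact (dcomp b a) (dcomp d c) x = bact a c (bact b d x) }.

Record bmap (X Y : bsSet) := BMap {
  bfun :> forall m n, X m n -> Y m n;
  bnat : forall m m' n n' (a : dmap m m') (c : dmap n n') (x : X m' n'),
    bfun (bact a c x) = bact a c (bfun x) }.

Lemma bmap_ext (X Y : bsSet) (f g : bmap X Y) :
  (forall m n x, f m n x = g m n x) -> f = g.
Proof.
case: f g => [f hf] [g hg] /= E.
have {}E : f = g.
  apply: functional_extensionality_dep => m.
  by apply: functional_extensionality_dep => n; apply/funext/E.
by rewrite -{}E in hg *; congr BMap; apply: Prop_irrelevance.
Qed.

Program Definition bcomp (X Y Z : bsSet) (g : bmap Y Z) (f : bmap X Y) :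
  bmap X Z := @BMap X Z (fun m n x => g m n (f m n x)) _.
Next Obligation. by move=> X Y Z g f m m' n n' a c x /=; rewrite !bnat. Qed.

Program Definition box (A B : sSet) : bsSet :=
  @BSSet (fun m n => (A m * B n)%type)
    (fun m m' n n' a c x => (sact a x.1, sact c x.2)) _ _.
Next Obligation. by move=> A B m n [x y] /=; rewrite !sact_id. Qed.
Next Obligation.
by move=> A B m m' m'' n n' n'' b a d c [x y] /=; rewrite !sact_comp.
Qed.

Program Definition boxmap (A A' B B' : sSet) (u : smap A A') (v : smap B B') :
  bmap (box A B) (box A' B') :=
  @BMap (box A B) (box A' B') (fun m n x => (u m x.1, v n x.2)) _.
Next Obligation.
by move=> A A' B B' u v m m' n n' a c [x y] /=; rewrite /= !snat.
Qed.

(* The map Delta^m [] Delta^n -> X classifying an element of X_mn. *)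
Program Definition byo (X : bsSet) m n (x : X m n) :
  bmap (box (Delta m) (Delta n)) X :=
  @BMap (box (Delta m) (Delta n)) X (fun _ _ ab => bact ab.1 ab.2 x) _.
Next Obligation. by move=> X m n x p p' q q' a c [b d] /=; rewrite -bact_comp. Qed.

(* A \ X *)
Program Definition ldiv (A : sSet) (X : bsSet) : sSet :=
  @SSet (fun n => bmap (box A (Delta n)) X)
    (fun m n a phi => bcomp phi (boxmap (sid A) (Deltamap a))) _ _.
Next Obligation.
move=> A X n phi /=; apply: bmap_ext => p q [x y] /=.
by congr (phi _ _ (_, _)); apply: dmap_ext.
Qed.
Next Obligation.
move=> A X m n k b a phi /=; apply: bmap_ext => p q [x y] /=.
by congr (phi _ _ (_, _)); apply: dmap_ext.
Qed.

(* X / A *)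
Program Definition rdiv (X : bsSet) (A : sSet) : sSet :=
  @SSet (fun n => bmap (box (Delta n) A) X)
    (fun m n a phi => bcomp phi (boxmap (Deltamap a) (sid A))) _ _.
Next Obligation.
move=> X A n phi /=; apply: bmap_ext => p q [x y] /=.
by congr (phi _ _ (_, _)); apply: dmap_ext.
Qed.
Next Obligation.
move=> X A m n k b a phi /=; apply: bmap_ext => p q [x y] /=.
by congr (phi _ _ (_, _)); apply: dmap_ext.
Qed.

(* u \ X *)
Program Definition ldivl (A A' : sSet) (u : smap A A') (X : bsSet) :
  smap (ldiv A' X) (ldiv A X) :=
  @SMap (ldiv A' X) (ldiv A X)
    (fun n phi => bcomp phi (boxmap u (sid (Delta n)))) _.
Next Obligation. by move=> A A' u X m n a phi /=; apply: bmap_ext. Qed.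

(* A \ f *)
Program Definition ldivr (A : sSet) (X Y : bsSet) (f : bmap X Y) :
  smap (ldiv A X) (ldiv A Y) :=
  @SMap (ldiv A X) (ldiv A Y) (fun n phi => bcomp f phi) _.
Next Obligation. by move=> A X Y f m n a phi /=; apply: bmap_ext. Qed.

(* f / A *)
Program Definition rdivl (X Y : bsSet) (f : bmap X Y) (A : sSet) :
  smap (rdiv X A) (rdiv Y A) :=
  @SMap (rdiv X A) (rdiv Y A) (fun n phi => bcomp f phi) _.
Next Obligation. by move=> X Y f A m n a phi /=; apply: bmap_ext. Qed.

(* <u \ f> : A' \ X -> A \ X x_{A \ Y} A' \ Y *)
Program Definition ldiv_gap (A A' : sSet) (u : smap A A')
    (X Y : bsSet) (f : bmap X Y) :
  smap (ldiv A' X) (pb (ldivr A f) (ldivl u Y)) :=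
  pb_pair (p := ldivl u X) (q := ldivr A' f) _.
Next Obligation. by move=> A A' u X Y f n phi /=; apply: bmap_ext. Qed.

Definition reedy_fibration (X Y : bsSet) (f : bmap X Y) : Prop :=
  forall (A A' : sSet) (u : smap A A'), smono u ->
    kan_fibration (ldiv_gap u f).

Definition bpt : bsSet :=
  @BSSet (fun _ _ => unit) (fun _ _ _ _ _ _ x => x)
    (fun _ _ _ => erefl) (fun _ _ _ _ _ _ _ _ _ _ _ => erefl).

Definition to_bpt (X : bsSet) : bmap X bpt :=
  @BMap X bpt (fun _ _ _ => tt) (fun _ _ _ _ _ _ _ => erefl).

Definition reedy_fibrant (X : bsSet) : Prop := reedy_fibration (to_bpt X).

Definition segal_space (X : bsSet) : Prop :=
  reedy_fibrant X /\ forall n, 2 <= n -> weq (ldivl (sincl (spine n)) X).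

(* The vertex of Delta^1 \ X corresponding to e in X_10, as a map from the
   point; its image is {e}. *)
Definition at_edge (X : bsSet) (e : X 1 0) : smap (Delta 0) (ldiv (Delta 1) X) :=
  @yo (ldiv (Delta 1) X) 0 (byo e).

(* (A \ X)^e = A \ X x_{Delta^1 \ X} {e}, for a simplicial set A with a
   distinguished edge s : Delta^1 -> A; for A a simplicial subset of Delta^n
   this is used with s the edge Delta^{0,1}. *)
Definition lfib (A : sSet) (s : A 1) (X : bsSet) (e : X 1 0) : sSet :=
  pb (ldivl (yo s) X) (at_edge e).

Program Definition lfibl (A A' : sSet) (u : smap A A') (s : A 1)
    (X : bsSet) (e : X 1 0) :
  smap (lfib (u 1 s) e) (lfib s e) :=
  pb_pair (p := scomp (ldivl u X) (pb_fst _ _)) (q := pb_snd _ _) _.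
Next Obligation.
move=> A A' u s X e n t.
transitivity (ldivl (yo (u 1 s)) X n (pb_fst _ _ n t)); last exact: pb_comm.
by apply: bmap_ext => p q [x y] /=; rewrite snat.
Qed.

Program Definition lfibr (A : sSet) (s : A 1) (X Y : bsSet) (f : bmap X Y)
    (e : X 1 0) :
  smap (lfib s e) (lfib s (f 1 0 e)) :=
  pb_pair (p := scomp (ldivr A f) (pb_fst _ _)) (q := pb_snd _ _) _.
Next Obligation.
move=> A s X Y f e n t.
have -> : at_edge (f 1 0 e) = scomp (ldivr (Delta 1) f) (at_edge e).
  apply: smap_ext => k a; apply: bmap_ext => p q [x y] /=.
  by rewrite -bnat.
transitivity (ldivr (Delta 1) f n (ldivl (yo s) X n (pb_fst _ _ n t))).
  exact: bmap_ext.
by rewrite pb_comm.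
Qed.

Lemma d01_in_horn n : smem (horn (n := n.+2) ord0) (d01 n.+1).
Proof.
exists (Ordinal (n := n.+3) (m := 2) isT); first by case.
by move=> [[|[|j]] hj] //; case.
Qed.

(* The edge Delta^{0,1} of the horn Lambda^n_0, for n >= 2. *)
Definition horn01 n : horn (n := n.+2) ord0 1 :=
  exist _ (d01 n.+1) (d01_in_horn n).

Lemma cocart_square (A A' : sSet) (u : smap A A') (s : A 1)
    (X Y : bsSet) (f : bmap X Y) (e : X 1 0) :
  scomp (lfibr s f e) (lfibl u s e)
  = scomp (lfibl u s (f 1 0 e)) (lfibr (u 1 s) f e).
Proof.
by apply: smap_ext => n t; apply: eq_exist; congr pair; apply: bmap_ext.
Qed.

Definition segal_cocartesian (X Y : bsSet) (f : bmap X Y) (e : X 1 0) : Prop :=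
  homotopy_pullback (cocart_square (sincl (horn (n := 2) ord0)) (horn01 0) f e).

(* The source of e is its restriction to the vertex 0 of Delta^1. *)
Definition bsource (X : bsSet) (e : X 1 0) : X 0 0 :=
  bact (dconst 0 ord0) (did 0) e.

Definition segal_cocartesian_fibration (X Y : bsSet) (f : bmap X Y) : Prop :=
  [/\ segal_space X, segal_space Y, reedy_fibration f
    & forall (e : Y 1 0) (x : X 0 0), f 0 0 x = bsource e ->
      exists e' : X 1 0,
        [/\ bsource e' = x, f 1 0 e' = e & segal_cocartesian f e']].

Definition inner_fibration (S T : sSet) (p : smap S T) : Prop :=
  forall n (k : 'I_n.+1), 0 < k < n -> lifts (sincl (horn k)) p.

Definition quasicategory (S : sSet) : Prop := inner_fibration (to_pt S).

(* Every lifting problem of Lambda^n_0 -> Delta^n, n >= 2, against p in which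
   Delta^{0,1} is sent to e has a solution. *)
Definition qcat_cocartesian (S T : sSet) (p : smap S T) (e : S 1) : Prop :=
  forall n (u : smap (horn (n := n.+2) ord0) S) (v : smap (Delta n.+2) T),
    u 1 (horn01 n) = e ->
    scomp p u = scomp v (sincl (horn ord0)) ->
    exists2 w : smap (Delta n.+2) S,
      scomp w (sincl (horn ord0)) = u & scomp p w = v.

Definition ssource (S : sSet) (e : S 1) : S 0 := sact (dconst 0 ord0) e.

Definition qcat_cocartesian_fibration (S T : sSet) (p : smap S T) : Prop :=
  [/\ quasicategory S, quasicategory T, inner_fibration p
    & forall (e : T 1) (x : S 0), p 0 x = ssource e ->
      exists e' : S 1,
        [/\ ssource e' = x, p 1 e' = e & qcat_cocartesian p e']].

(* Main.v *)
(** Lifting an inclusion u against [f / Delta^0] amounts to lifting a vertex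
    through [<u \ f>], so it suffices that [<u \ f>] is a trivial fibration. As f
    is Reedy, the class C of inclusions u with this property is closed under
    pushouts, composition and right cancellation. A Kan fibration between Kan
    complexes that is a weak equivalence is a trivial fibration, so the Segal
    condition puts the spines in C; attaching faces of a simplex one at a time
    then puts the inner horns in C. For a cocartesian morphism e the same
    applies to the problems in which the edge [Delta^{0,1}] is sent constantly to
    e: the defining homotopy pullback puts [Lambda^2_0] in this larger class, and
    a similar induction on faces yields all [Lambda^n_0]. *)
From Stdlib Require Import Relation_Operators.
From mathcomp Require Import all_boot zify.
From mathcomp Require Import boolp.
Require Import Defs.

Set Implicit Arguments.
Unset Strict Implicit.
Unset Printing Implicit Defensive.
#[local] Obligation Tactic := idtac.

(** * Lifting along pushouts and unions *)

(** Right cancellation dictates the form of the lifting problems: its proof compares a lift with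
    prescribed values by a homotopy, and finding this homotopy is again a lifting problem, over
    [L x Delta^1] in place of [L]. So the class C is tested against all inclusions [M -> L] at once,
    and Kan fibrations must lift homotopies relative to arbitrary inclusions; hence the prism
    filtration and the skeletal induction. Weak equivalences are defined through homotopy classes of
    maps into Kan complexes, so a Kan fibration of Kan complexes that is one is shown to be trivial
    by constructing a section and a fibrewise deformation onto it. The homotopy pullback turns into
    a weak equivalence onto the strict pullback, since one leg of that pullback is already a Kan
    fibration. *)

Lemma smap_app (A B : sSet) (f g : smap A B) n (x : A n) :
  f = g -> f n x = g n x.
Proof. by move=> ->. Qed.

Lemma ssub_ext (A : sSet) (P Q : ssub A) :
  (forall n (x : A n), smem P x <-> smem Q x) -> P = Q.
Proof.
case: P Q => [P hP] [Q hQ] /= E.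
have {}E : P = Q.
  by apply: functional_extensionality_dep => n; apply/funext => x; apply/propext.
by rewrite -{}E in hQ *; congr SSub; apply: Prop_irrelevance.
Qed.

Lemma sincl_mono (A : sSet) (P : ssub A) : smono (sincl P).
Proof. by move=> n [x hx] [y hy] /= E; apply: eq_exist. Qed.

(** Naturality follows from uniqueness, so the values may be chosen independently. *)
Lemma smap_of_rel (A S : sSet) (R : forall n, A n -> S n -> Prop) :
  (forall n x, exists y, R n x y) ->
  (forall n x y y', R n x y -> R n x y' -> y = y') ->
  (forall m n (a : dmap m n) x y, R n x y -> R m (sact a x) (sact a y)) ->
  exists W : smap A S, forall n x, R n x (W n x).
Proof.
move=> Rt Rf Ra; pose w n x := sval (cid (Rt n x)).
have wP n x : R n x (w n x) by rewrite /w; case: cid.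
have wn m n (a : dmap m n) x : w m (sact a x) = sact a (w n x).
  by apply: Rf (wP _ _) _; apply: Ra.
by exists (SMap wn).
Qed.

Section Glue.
Variables (B D S : sSet) (P Q : ssub B) (x : smap D B).
Hypothesis cover : forall n (y : B n),
  smem Q y -> smem P y \/ exists d, y = x n d.

Lemma glue (u : smap P S) (w : smap D S) :
  (forall n d (h : smem P (x n d)), w n d = u n (exist _ _ h)) ->
  (forall n d d', x n d = x n d' -> w n d = w n d') ->
  exists W : smap Q S,
    (forall n y (hQ : smem Q y) (hP : smem P y),
       W n (exist _ y hQ) = u n (exist _ y hP)) /\
    (forall n d (hQ : smem Q (x n d)), W n (exist _ _ hQ) = w n d).
Proof.
move=> uw ww.
pose R n (y : Q n) (z : S n) :=
  (exists hP : smem P (sval y), z = u n (exist _ _ hP)) \/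
  (exists2 d, sval y = x n d & z = w n d).
have Rf n (y : Q n) z z' : R n y z -> R n y z' -> z = z'.
  case=> [[h ->]|[d e ->]]; case=> [[h' ->]|[d' e' ->]].
  - by congr (u n _); apply: eq_exist.
  - by move: h; rewrite e' => h; rewrite uw.
  - by move: h'; rewrite e => h'; rewrite uw.
  - by apply: ww; rewrite -e -e'.
have [||W hW] := @smap_of_rel Q S R _ Rf.
- move=> n [y hy]; case: (cover hy) => [h|[d e]].
    by exists (u n (exist _ y h)); left; exists h.
  by exists (w n d); right; exists d.
- move=> m n a y z [[h ->]|[d e ->]].
    left; exists (smem_act a h); rewrite -snat; congr (u m _).
    exact: eq_exist.
  by right; exists (sact a d); rewrite /= ?snat // e.
exists W; split=> [n y hQ hP|n d hQ].
  by apply: Rf (hW _ _) _; left; exists hP.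
by apply: Rf (hW _ _) _; right; exists d.
Qed.

End Glue.

Program Definition spre (D B : sSet) (x : smap D B) (P : ssub B) : ssub D :=
  @SSub D (fun n d => smem P (x n d)) _.
Next Obligation. by move=> D B x P m n a d h /=; rewrite snat; apply: smem_act. Qed.

Program Definition sprem (D B : sSet) (x : smap D B) (P : ssub B) :
  smap (spre x P) P :=
  @SMap (spre x P) P (fun n d => exist _ (x n (sval d)) (svalP d)) _.
Next Obligation. by move=> D B x P m n a d; apply: eq_exist; rewrite /= snat. Qed.

Section Rlp.
Variables (E T : sSet) (p : smap E T).

Definition rlp (B : sSet) (P : ssub B) : Prop :=
  forall (u : smap P E) (v : smap B T),
  (forall n y (h : smem P y), p n (u n (exist _ y h)) = v n y) ->
  exists w : smap B E,
    (forall n y (h : smem P y), w n y = u n (exist _ y h)) /\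
    (forall n y, p n (w n y) = v n y).

Lemma rlpP (B : sSet) (P : ssub B) : lifts (sincl P) p <-> rlp P.
Proof.
split=> [H u v uv|H u v uv].
  have [|w wu wv] := H u v.
    by apply: smap_ext => n [y h]; apply: uv.
  by exists w; split=> [n y h|n y]; rewrite -?wu -?wv.
have [|w [wu wv]] := H u v.
  by move=> n y h; have := @smap_app _ _ _ _ n (exist _ y h : P n) uv.
by exists w; apply: smap_ext => // n [y h]; apply: wu.
Qed.

(** [v] is given on all of [B], so that the stages of a filtration share one base map. *)
Definition ext (B : sSet) (P Q : ssub B) : Prop :=
  forall (u : smap P E) (v : smap B T),
  (forall n y (h : smem P y), p n (u n (exist _ y h)) = v n y) ->
  exists w : smap Q E,
    (forall n y (hP : smem P y) (hQ : smem Q y),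
      w n (exist _ y hQ) = u n (exist _ y hP)) /\
    (forall n y (h : smem Q y), p n (w n (exist _ y h)) = v n y).

Lemma ext_full (B : sSet) (P Q : ssub B) :
  (forall n (y : B n), smem Q y) -> ext P Q -> rlp P.
Proof.
move=> Qt H u v uv; have [w [wu wv]] := H u v uv.
have wn m n (a : dmap m n) (y : B n) :
    w m (exist _ (sact a y) (Qt _ _)) = sact a (w n (exist _ y (Qt _ _))).
  by rewrite -snat; congr (w m _); apply: eq_exist.
exists (SMap wn); split=> [n y h|n y] /=; last exact: wv.
exact: wu.
Qed.

(** Cell attachment: [x] may identify simplices of [D], but only where it lands in [P], and there
    [u] already prescribes the lift. *)
Lemma ext_attach (B D : sSet) (P Q : ssub B) (x : smap D B) :
  (forall n (y : B n), smem Q y -> smem P y \/ exists d, y = x n d) ->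
  (forall n d d', x n d = x n d' -> ~ smem P (x n d) -> d = d') ->
  rlp (spre x P) -> ext P Q.
Proof.
move=> cover inj lp u v uv.
have [|w [wu wv]] := lp (scomp u (sprem x P)) (scomp v x).
  by move=> n y h /=; apply: uv.
have wu' n d (h : smem P (x n d)) : w n d = u n (exist _ _ h).
  by rewrite (wu n d h) /=; congr (u n _); apply: eq_exist.
have [||W [WP WD]] := @glue B D E P Q x cover u w.
- exact: wu'.
- move=> n d d' e; case: (pselect (smem P (x n d))) => h; last by rewrite (inj n d d').
  have h' : smem P (x n d') by rewrite -e.
  by rewrite (wu' n d h) (wu' n d' h'); congr (u n _); apply: eq_exist.
exists W; split=> [n y hP hQ|n y hQ]; first exact: WP.
case: (cover n y hQ) => [hP|[d e]]; first by rewrite (WP _ _ _ hP) uv.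
by move: hQ; rewrite e => hQ; rewrite WD wv.
Qed.

Lemma ext_tower (B : sSet) (P : nat -> ssub B) :
  (forall k n (y : B n), smem (P k) y -> smem (P k.+1) y) ->
  (forall n (y : B n), exists k, smem (P k) y) ->
  (forall k, ext (P k) (P k.+1)) -> rlp (P 0).
Proof.
move=> Pm Pt H u v uv.
pose ok k (w : smap (P k) E) :=
  forall n y (h : smem (P k) y), p n (w n (exist _ y h)) = v n y.
pose step k (w : {w : smap (P k) E | ok k w}) : {w : smap (P k.+1) E | ok k.+1 w} :=
  let W := cid (H k (sval w) v (svalP w)) in
  exist _ (sval W) (proj2 (svalP W)).
pose w := nat_rect (fun k => {w : smap (P k) E | ok k w}) (exist _ u uv) step.
have w1 k n y h h' : sval (w k.+1) n (exist _ y h) = sval (w k) n (exist _ y h').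
  by rewrite /= ; case: cid => W [WP ?] /=; apply: WP.
have Pm' j k n (y : B n) : smem (P k) y -> smem (P (j + k)) y.
  by elim: j => // j IH h; apply/Pm/IH.
have w2 j k n y h h' : sval (w (j + k)) n (exist _ y h) = sval (w k) n (exist _ y h').
  elim: j h => [|j IH] h; first by rewrite (Prop_irrelevance h h').
  by rewrite (w1 (j + k) _ _ _ (Pm' j _ _ _ h')).
(* Stages [j] and [k] are compared at the common stage [j + k]. *)
have w3 j k n y h h' : sval (w j) n (exist _ y h) = sval (w k) n (exist _ y h').
  rewrite -(w2 k j _ _ (Pm' _ _ _ _ h)) -(w2 j k _ _ (Pm' _ _ _ _ h')).
  by move: (Pm' _ _ _ _ _) (Pm' _ _ _ _ _); rewrite addnC => h1 h2;
    rewrite (Prop_irrelevance h1 h2).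
pose R n (y : B n) (z : E n) := exists k h, z = sval (w k) n (exist _ y h).
have Rf n (y : B n) z z' : R n y z -> R n y z' -> z = z'.
  by case=> [k [h ->]] [k' [h' ->]]; apply: w3.
have [||W hW] := @smap_of_rel B E R _ Rf.
- by move=> n y; have [k h] := Pt n y; exists (sval (w k) n (exist _ y h)), k, h.
- move=> m n a y _ [k [h ->]]; exists k, (smem_act a h).
  by rewrite -snat; congr (sval (w k) m _); apply: eq_exist.
exists W; split=> [n y h|n y].
  by apply: Rf (hW n y) _; exists 0, h.
by have [k [h ->]] := hW n y; apply: (svalP (w k)).
Qed.

End Rlp.

(** * Homotopy lifting for Kan fibrations *)

Local Notation I := (Delta 1).

Lemma rlp_ext (E T : sSet) (p : smap E T) (B : sSet) (P Q : ssub B) :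
  (forall n (y : B n), smem P y -> smem Q y) -> ext p P Q -> rlp p Q -> rlp p P.
Proof.
move=> PQ H1 H2 u v uv; have [w [wu wv]] := H1 u v uv.
have [z [zw zv]] := H2 w v wv.
by exists z; split=> // n y h; rewrite (zw _ _ (PQ _ _ h)) (wu _ _ h).
Qed.

Lemma dconst_comp m n k (i : 'I_k.+1) (a : dmap m n) :
  dcomp (dconst n i) a = dconst m i.
Proof. exact: dmap_ext. Qed.

(** The pushout product of [M -> L] with the vertex 0 of Delta^1; lifting against it is homotopy
    lifting relative to [M]. *)
Program Definition prism_sub (L : sSet) (M : ssub L) : ssub (sprod L I) :=
  @SSub (sprod L I) (fun n y => smem M y.1 \/ y.2 = dconst n ord0) _.
Next Obligation.
move=> L M m n a [l t] /= [h|->]; first by left; apply: smem_act.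
by right; rewrite dconst_comp.
Qed.

Program Definition bdry n : ssub (Delta n) :=
  @SSub (Delta n) (fun m a => exists i, forall j, a j <> i) _.
Next Obligation. by move=> n m p a x [i hi] /=; exists i => j; apply: hi. Qed.

Section Prism.
Variables (E T : sSet) (p : smap E T).
Hypothesis pkan : kan_fibration p.

(* (a, t) factors through the j-th shuffle
   (0,0) < ... < (j,0) < (j,1) < ... < (n,1). *)
Definition in_shuffle n j m (a : dmap m n) (t : dmap m 1) : Prop :=
  forall s, (t s = 0 :> nat -> a s <= j) /\ (t s = 1 :> nat -> j <= a s).

(** Shuffles enter from [j = n] down to [j = 0]: stage [n.+1] is the prism over the boundary
    together with the bottom, stage 0 the whole prism. *)
Program Definition shuffles n i : ssub (sprod (Delta n) I) :=
  @SSub (sprod (Delta n) I) (fun m y => smem (prism_sub (bdry n)) y \/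
     exists2 j, i <= j & in_shuffle j (y.1 : dmap m n) y.2) _.
Next Obligation.
move=> n i m k a y /= [h|[j ij h]]; first left.
  exact: (@smem_act _ (prism_sub (bdry n)) _ _ a y h).
by right; exists j => // s; apply: h.
Qed.


Section Shuffle.
Variables (n : nat) (i : 'I_n.+1).

Lemma shuffle_fst_lt (k : 'I_n.+2) : k - (i < k) < n.+1.
Proof. by have := ltn_ord k; have := ltn_ord i; lia. Qed.

Lemma shuffle_snd_lt (k : 'I_n.+2) : (i < k) < 2.
Proof. by case: (i < k). Qed.

Definition shuffle_fst : dmap n.+1 n.
Proof.
apply: (@Dmap n.+1 n (fun k => Ordinal (shuffle_fst_lt k))) => k l /=.
by lia.
Defined.

Definition shuffle_snd : dmap n.+1 1.
Proof.
apply: (@Dmap n.+1 1 (fun k => Ordinal (shuffle_snd_lt k))) => k l /=.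
by lia.
Defined.

Definition shuffle : smap (Delta n.+1) (sprod (Delta n) I) :=
  @yo (sprod (Delta n) I) n.+1 (shuffle_fst, shuffle_snd).

Lemma shuffle_inj m (c d : dmap m n.+1) : shuffle m c = shuffle m d -> c = d.
Proof.
case=> e1 e2; apply: dmap_ext => s; apply: val_inj => /=.
have := congr1 (fun a => val (a s)) e1.
have := congr1 (fun a => val (a s)) e2.
by rewrite /=; case: (ltnP i (c s)); case: (ltnP i (d s)) => //=; lia.
Qed.

Lemma shuffle_cover m (y : sprod (Delta n) I m) : smem (shuffles n i) y ->
  smem (shuffles n i.+1) y \/ exists c, y = shuffle m c.
Proof.
case: y => [a t] [h|[j ij]]; first by left; left.
move=> /= h.
move: ij; rewrite leq_eqVlt => /orP[/eqP e|ij]; last by left; right; exists j.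
right.
(* Along the [i]-th shuffle, the position of a vertex is the sum of its coordinates. *)
have lt s : a s + t s < n.+2 by have := ltn_ord (a s); have := ltn_ord (t s); lia.
have mn (s s' : 'I_m.+1) : s <= s' ->
    (Ordinal (lt s) : 'I_n.+2) <= (Ordinal (lt s') : 'I_n.+2).
  by move=> ss /=; apply: leq_add; apply: dmono.
have key s : (t s = 0 :> nat /\ a s <= i) \/ (t s = 1 :> nat /\ i <= a s).
  have [] := h s; rewrite -e; have := ltn_ord (t s).
  case: (nat_of_ord (t s)) => [|[|//]] _ h0 h1; [left|right]; split=> //.
    exact: h0.
  exact: h1.
exists (Dmap mn); congr pair; apply: dmap_ext => s; apply: val_inj => /=;
  by case: (key s) => -[-> ?]; lia.
Qed.

(** Face [i.+1] is shared with the shuffle [i.+1], or is in the bottom if [i = n]. Face [i] is the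
    missing one: it belongs to the shuffle [i - 1], attached later, or is the top of the prism if
    [i = 0]. All other faces lie over the boundary. *)
Lemma shuffle_horn :
  spre shuffle (shuffles n i.+1) = horn (widen_ord (leqnSn _) i).
Proof.
apply: ssub_ext => m c; split=> /=.
  have hn : i < n.+1 by [].
  case=> [[[k hk]|hc]|[j ij h]].
  - have [ki|ik] := ltnP k i.
      exists (widen_ord (leqnSn _) k).
        by move=> e; have := congr1 val e; rewrite /=; lia.
      move=> s e; apply: (hk s); apply: val_inj => /=.
      by have := congr1 val e; rewrite /=; lia.
    have kn : k.+1 < n.+2 by have := ltn_ord k; lia.
    exists (Ordinal kn).
      by move=> e; have := congr1 val e; rewrite /=; lia.
    move=> s e; apply: (hk s); apply: val_inj => /=.
    by have := congr1 val e; rewrite /=; lia.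
  - exists (lift ord0 i).
      by move=> e; have := congr1 val e; rewrite /= /bump /=; lia.
    move=> s e; have := congr1 (fun a : dmap m 1 => val (a s)) hc.
    by rewrite /= e /= /bump /=; lia.
  - exists (lift ord0 i).
      by move=> e; have := congr1 val e; rewrite /= /bump /=; lia.
    move=> s e; have [_] := h s; rewrite /= e /= /bump /=; lia.
case=> k ki hk.
have {}ki : k <> i :> nat by move=> e; apply: ki; apply: val_inj.
have hk' s : c s <> k :> nat by move=> e; apply: (hk s); apply: val_inj.
have [lki|lik] := ltnP k i.
  have kn : k < n.+1 by have := ltn_ord i; lia.
  left; left; exists (Ordinal kn) => s e; apply: (hk' s).
  by have := congr1 val e; rewrite /=; lia.
have [lk|lk] := ltnP i.+1 k.
  have kn : k.-1 < n.+1 by have := ltn_ord k; lia.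
  left; left; exists (Ordinal kn) => s e; apply: (hk' s).
  by have := congr1 val e; rewrite /=; lia.
right; exists i.+1 => // s /=; have := hk' s; by lia.
Qed.

Lemma ext_shuffle : ext p (shuffles n i.+1) (shuffles n i).
Proof.
apply: (@ext_attach _ _ p _ _ _ _ shuffle).
- exact: shuffle_cover.
- by move=> m c d e _; apply: shuffle_inj.
- by rewrite shuffle_horn; apply/rlpP/pkan.
Qed.

End Shuffle.

Lemma rlp_prism_bdry n : rlp p (prism_sub (bdry n)).
Proof.
(* A shuffle with [j > n] has no vertex over 1, hence lies in the bottom of the prism. *)
have -> : prism_sub (bdry n) = shuffles n n.+1.
  apply: ssub_ext => m [a t]; split=> [h|[//|[j ij h]]]; first by left.
  right; apply: dmap_ext => s; apply: val_inj => /=.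
  have [_] := h s; have := ltn_ord (a s); have := ltn_ord (t s) => /=.
  by case: (nat_of_ord (t s)) => [|[|//]] // _ ? /(_ erefl); lia.
have : n.+1 <= n.+1 by [].
elim: {1 3}n.+1 => [_|i IH ni].
  apply: (@ext_full _ _ p _ _ (shuffles n 0)); last first.
    move=> u v uv; exists u; split=> // k y hP hQ.
    by rewrite (Prop_irrelevance hP hQ).
  move=> m [a t] /=; case: (pselect (exists s, t s = 1 :> nat)) => [ex|nex].
    have ex' : exists k, [exists s : 'I_m.+1, (k == s :> nat) && (t s == 1 :> nat)].
      by case: ex => s es; exists s; apply/existsP; exists s; rewrite eqxx es.
    (* The shuffle is read off at the first vertex lying over 1. *)
    right; case: (ex_minnP ex') => _ /existsP[s /andP[/eqP -> /eqP es]] smin.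
    exists (a s) => // s' /=; split=> e; apply: dmono.
      rewrite leqNgt; apply/negP => /ltnW /(dmono t); by rewrite es e.
    by apply: smin; apply/existsP; exists s'; rewrite eqxx e eqxx.
  left; right; apply: dmap_ext => s; apply: val_inj => /=.
  have := ltn_ord (t s); case e: (nat_of_ord (t s)) => [|[|]] // _.
  by case: nex; exists s.
apply: (rlp_ext _ (@ext_shuffle n (Ordinal ni)) (IH (ltnW ni))) => m y /= [|[j ij h]].
  by left.
by right; exists j => //; apply: ltnW.
Qed.

End Prism.

(** * Relative skeleta and their cells *)

Lemma dlift_mono n (i : 'I_n.+2) (j k : 'I_n.+1) : j <= k -> lift i j <= lift i k.
Proof. by rewrite /= /bump; lia. Qed.

Definition dlift n (i : 'I_n.+2) : dmap n n.+1 := Dmap (dlift_mono i).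

Lemma dlift_factor m n (i : 'I_n.+2) (b : dmap m n.+1) :
  (forall s, b s <> i) -> exists b', b = dcomp (dlift i) b'.
Proof.
move=> hb.
have ub s : exists j, b s = lift i j.
  case: (unliftP i (b s)) => [j ->|e]; first by exists j.
  by case: (hb s).
pose b' s := sval (cid (ub s)).
have bE s : b s = lift i (b' s) by rewrite /b'; case: cid.
have mn (s s' : 'I_m.+1) : s <= s' -> b' s <= b' s'.
  by move=> /(dmono b); rewrite !bE /= /bump; lia.
by exists (Dmap mn); apply: dmap_ext.
Qed.

Lemma dlift_neq n (i : 'I_n.+2) m (b : dmap m n) s : dcomp (dlift i) b s <> i.
Proof. by apply/eqP; rewrite eq_sym neq_lift. Qed.

(** Every right inverse of a monotone surjection is monotone, so its value at [a i] can be
    prescribed freely. *)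
Lemma dmap_section m k (a : dmap m k) (i : 'I_m.+1) :
  (forall j, exists s, a s = j) ->
  exists2 s : dmap k m, (forall j, a (s j) = j) & s (a i) = i.
Proof.
move=> sa; pose s j := if j == a i then i else sval (cid (sa j)).
have sE j : a (s j) = j by rewrite /s; case: eqP => [->|_] //; case: cid.
have mn (j j' : 'I_k.+1) : j <= j' -> s j <= s j'.
  rewrite leq_eqVlt => /orP[/eqP/val_inj -> //|jj].
  rewrite leqNgt; apply/negP => /ltnW /(dmono a).
  by rewrite !sE leqNgt jj.
by exists (Dmap mn) => //=; rewrite /s eqxx.
Qed.

(** An injective monotone self-map lies above the identity. This applies to [e] and to its inverse
    [s]. *)
Lemma dmap_endo_surj k (e : dmap k k) : (forall j, exists s, e s = j) -> e = did k.
Proof.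
have incr (d : dmap k k) : injective d -> forall j : 'I_k.+1, j <= d j.
  move=> dI j; case: j => j; elim: j => [//|j IH] hj.
  have hj' := ltnW hj; apply: leq_ltn_trans (IH hj') _.
  rewrite ltn_neqAle dmono ?andbT //= ?leqnSn //.
  by apply/eqP => /val_inj/dI/(congr1 val) /=; lia.
move=> se; have [s es _] := dmap_section ord0 se.
have sI : injective s by move=> j j' E; rewrite -[j]es E es.
have eI : injective e.
  have sb : bijective s by apply: injF_bij.
  case: sb => t st ts j j' E; rewrite -[j]ts -[j']ts; congr (s _).
  by rewrite -[t j]es -[t j']es !ts.
apply: dmap_ext => j; apply: val_inj => /=; apply/eqP; rewrite eqn_leq incr // andbT.
by have := incr s sI (e j); have -> : s (e j) = j by apply: eI; rewrite es.
Qed.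

Section Skeleton.
Variables (L : sSet) (M : ssub L).

(** The bound is strict: stage [k] is the relative (k-1)-skeleton, and stage 0 is [M]. *)
Program Definition skel k : ssub L :=
  @SSub L (fun m l => smem M l \/
    exists j (a : dmap m j) (y : L j), j < k /\ l = sact a y) _.
Next Obligation.
move=> k m n a l [h|[j [b [y [jk ->]]]]]; first by left; apply: smem_act.
by right; exists j, (dcomp b a), y; rewrite sact_comp.
Qed.

(** An operator that misses a vertex factors through a face, which has lower dimension. *)
Lemma skel_surj k (y : L k) m (a : dmap m k) :
  ~ smem (skel k) (sact a y) -> forall j, exists s, a s = j.
Proof.
move=> h j; apply: contrapT => ne; apply: h; right.
have ne' s : a s <> j by move=> e; apply: ne; exists s.
case: k y a j ne ne' => [|k] y a j _ ne'.
  by case: (ne' ord0); rewrite !ord1.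
have [b ->] := dlift_factor ne'.
by exists k, b, (sact (dlift j) y); rewrite sact_comp.
Qed.

(* Eilenberg-Zilber: a surjection is determined by its sections, and a
   degeneracy of y restricted along a section is y again. *)
Lemma skel_inj k (y y' : L k) m (a a' : dmap m k) :
  ~ smem (skel k) y -> ~ smem (skel k) (sact a y) ->
  sact a y = sact a' y' -> y = y' /\ a = a'.
Proof.
move=> hy ha e; have sa := skel_surj ha.
have sec (s : dmap k m) : (forall j, a (s j) = j) -> y = sact (dcomp a' s) y'.
  move=> hs; rewrite sact_comp -e -sact_comp -{1}[y]sact_id; congr sact.
  by apply: dmap_ext => j /=; rewrite hs.
have a's (s : dmap k m) : (forall j, a (s j) = j) -> dcomp a' s = did k.
  move=> /sec ys; apply: dmap_endo_surj; apply: (@skel_surj _ y').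
  by rewrite -ys.
split.
  have [s hs _] := dmap_section ord0 sa.
  by rewrite (sec _ hs) (a's _ hs) sact_id.
apply: dmap_ext => i; have [s hs si] := dmap_section i sa.
by rewrite -{2}si; have /(congr1 (fun d : dmap k k => d (a i))) /= -> := a's _ hs.
Qed.

End Skeleton.

(** The product with [disc J] is a disjoint union of copies indexed by [J]; with it all cells of one
    dimension are attached at once. *)
Program Definition disc (J : Type) : sSet :=
  @SSet (fun _ => J) (fun _ _ _ x => x) _ _.
Next Obligation. by []. Qed.
Next Obligation. by []. Qed.

Section HomotopyLifting.
Variables (E T : sSet) (p : smap E T).
Hypothesis pkan : kan_fibration p.

Section Cells.
Variables (L : sSet) (M : ssub L) (k : nat).

(** The nondegenerate k-simplices outside [M]. *)
Definition cells : Type := {y : L k | ~ smem (skel M k) y}.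

Program Definition attaching : smap (sprod (disc cells) (sprod (Delta k) I)) (sprod L I) :=
  @SMap (sprod (disc cells) (sprod (Delta k) I)) (sprod L I)
    (fun m d => (sact (d.2.1 : dmap m k) (sval d.1), d.2.2)) _.
Next Obligation. by move=> m n a [y [b t]] /=; rewrite -sact_comp. Qed.

Program Definition cell (y : cells) :
  smap (sprod (Delta k) I) (sprod (disc cells) (sprod (Delta k) I)) :=
  @SMap (sprod (Delta k) I) (sprod (disc cells) (sprod (Delta k) I))
    (fun m d => (y, d)) _.
Next Obligation. by []. Qed.

(** If [a] is surjective and [sact a y] lies in the lower skeleton, restriction along a section of
    [a] puts [y] there as well, a contradiction. *)
Lemma cell_bdry (y : cells) :
  spre (cell y) (spre attaching (prism_sub (skel M k))) = prism_sub (bdry k).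
Proof.
apply: ssub_ext => m [a t] /=; split=> -[h|->]; try (by right); left.
  apply: contrapT => nb; case: (svalP y).
  have sa j : exists s, a s = j.
    by apply: contrapT => ne; apply: nb; exists j => s e; apply: ne; exists s.
  have [s hs _] := dmap_section ord0 sa.
  have := @smem_act _ (skel M k) _ _ s _ h; rewrite -sact_comp.
  have -> : dcomp a s = did k by apply: dmap_ext => j /=; rewrite hs.
  by rewrite sact_id.
case: h => j hj; apply: contrapT => hn.
by have [s /hj] := @skel_surj _ M k _ m a hn j.
Qed.

Lemma ext_skel : ext p (prism_sub (skel M k)) (prism_sub (skel M k.+1)).
Proof.
apply: (@ext_attach _ _ p _ _ _ _ attaching).
- move=> m [l t] [[h|[j [a [y [jk /= ->]]]]]|/= ->].
  + by left; left; left.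
  + case: (pselect (smem (skel M k) (sact a y))) => h; first by left; left.
    right; have jE : j = k.
      apply/eqP; rewrite eqn_leq -ltnS jk leqNgt /=.
      by apply/negP => jk'; apply: h; right; exists j, a, y.
    subst j; have hy : ~ smem (skel M k) y by move=> hy; apply/h/smem_act.
    by exists (exist _ y hy, (a, t)).
  + by left; right.
- move=> m [[y hy] [a t]] [[y' hy'] [a' t']] /= [e <-] h.
  have [|e1 e2] := skel_inj hy _ e; first by move=> h'; apply: h; left.
  by subst y' a'; rewrite (Prop_irrelevance hy hy').
move=> u v uv.
have H (y : cells) : exists w : smap (sprod (Delta k) I) E,
    (forall n d h, w n d = u n (exist _ (y, d) h)) /\
    (forall n d, p n (w n d) = v n (y, d)).
  have : rlp p (prism_sub (bdry k)) by apply: rlp_prism_bdry.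
  rewrite -(cell_bdry y).
  move=> /(_ (scomp u (sprem (cell y) _)) (scomp v (cell y))) [].
    by move=> n d h; apply: uv.
  move=> w [wu wv]; exists w; split=> // n d h.
  by rewrite (wu n d h) /=; congr (u n _); apply: eq_exist.
(* Simplicial operators fix the index of the cell, so lifts chosen cell by cell form a simplicial
   map. *)
pose w n (d : sprod (disc cells) (sprod (Delta k) I) n) := sval (cid (H d.1)) n d.2.
have wn m n (a : dmap m n) d : w m (sact a d) = sact a (w n d) by rewrite /w -snat.
exists (SMap wn); split=> [n [y d] h|n [y d]] /=; rewrite /w; case: cid => z /= [z1 z2].
  exact: z1.
exact: z2.
Qed.

End Cells.

Theorem rlp_prism (L : sSet) (M : ssub L) : rlp p (prism_sub M).
Proof.
have -> : prism_sub M = prism_sub (skel M 0).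
  apply: ssub_ext => n [l t] /=; split=> -[h|->]; try (by right); left.
    by left.
  by case: h => // -[j [a [y []]]].
apply: (@ext_tower _ _ p _ (fun k => prism_sub (skel M k))).
- move=> k n [l t] [[h|[j [a [y [jk e]]]]]|h]; last by right.
    by left; left.
  by left; right; exists j, a, y; split=> //; apply: ltnW.
- move=> n [l t]; exists n.+1; left; right; exists n, (did n), l.
  by rewrite sact_id.
- by move=> k; apply: ext_skel.
Qed.

End HomotopyLifting.

(** * Kan fibrations that are weak equivalences *)

Local Notation c0 := (dconst _ (@ord0 1)).
Local Notation c1 := (dconst _ (@ord_max 1)).

Lemma ord2_neq0 (i : 'I_2) : i != ord0 -> i = ord_max.
Proof. by case: i => [[|[|]]] //= ? _; apply: val_inj. Qed.

Lemma dmap1_max0 m (t : dmap m 1) : t ord_max = ord0 -> t = c0.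
Proof.
move=> e; apply: dmap_ext => s; apply: val_inj => /=; apply/eqP.
by rewrite -leqn0; have := dmono t (leq_ord s : s <= @ord_max m); rewrite e.
Qed.

Lemma c0_neq_c1 m : c0 <> c1 :> dmap m 1.
Proof. by move=> /(congr1 (fun t : dmap m 1 => val (t ord0))). Qed.

Definition is_c0 m (t : dmap m 1) : bool := t ord_max == ord0.

Lemma is_c0P m (t : dmap m 1) : reflect (t = c0) (is_c0 t).
Proof. by apply: (iffP eqP) => [/dmap1_max0|->]. Qed.

Definition cst1 (A : sSet) k (i : 'I_k.+1) : smap A (Delta k) :=
  @SMap A (Delta k) (fun n _ => dconst n i) (fun _ _ _ _ => esym (dconst_comp _ _)).

Definition spair (A B C : sSet) (f : smap A B) (g : smap A C) : smap A (sprod B C).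
Proof.
apply: (@SMap A (sprod B C) (fun n x => (f n x, g n x))).
by move=> m n a x /=; rewrite !snat.
Defined.

Definition sfst (A B : sSet) : smap (sprod A B) A :=
  @SMap (sprod A B) A (fun n x => x.1) (fun _ _ _ _ => erefl).

Definition ssnd (A B : sSet) : smap (sprod A B) B :=
  @SMap (sprod A B) B (fun n x => x.2) (fun _ _ _ _ => erefl).

Definition at_end (A B : sSet) (H : smap (sprod A I) B) (i : 'I_2) : smap A B :=
  scomp H (spair (sid A) (cst1 A i)).

Section BoxFill.
Variables (E T : sSet) (p : smap E T).
Hypothesis pkan : kan_fibration p.

Program Definition ends (A : sSet) : ssub (sprod A I) :=
  @SSub (sprod A I) (fun n y => y.2 = c0 \/ y.2 = c1) _.
Next Obligation.
by move=> A m n a [x t] /= [->|->]; rewrite dconst_comp; [left|right].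
Qed.

(* An open square with left side G0, bottom side G1 and degenerate right side;
   H is its top side. *)
Lemma box_fill (A : sSet) (G0 G1 : smap (sprod A I) E)
    (S : smap (sprod (sprod A I) I) T) :
  (forall n x, G0 n (x, c0) = G1 n (x, c0)) ->
  (forall n x r, p n (G0 n (x, r)) = S n ((x, c0), r)) ->
  (forall n x t, p n (G1 n (x, t)) = S n ((x, t), c0)) ->
  (forall n x r, p n (G1 n (x, c1)) = S n ((x, c1), r)) ->
  exists H : smap (sprod A I) E,
    [/\ forall n x, H n (x, c0) = G0 n (x, c1),
        forall n x, H n (x, c1) = G1 n (x, c1)
      & forall n x t, p n (H n (x, t)) = S n ((x, t), c1)].
Proof.
move=> G01 pG0 pG1 pG1'.
(* Off the left side, [G1] with the second coordinate ignored is at once the bottom side and the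
   degenerate right side. *)
pose F n (y : prism_sub (ends A) n) : E n :=
  if is_c0 (sval y).1.2 then G0 n ((sval y).1.1, (sval y).2)
  else G1 n (sval y).1.
have Fn m n (a : dmap m n) y : F m (sact a y) = sact a (F n y).
  case: y => [[[x t] r] h]; rewrite /F /=.
  case: (is_c0P t) => [->|t0].
    by rewrite dconst_comp; case: is_c0P => // _; rewrite -snat.
  case: (is_c0P (dcomp t a)) => [ta0|_]; last by rewrite -snat.
  case: h => [[|/= t1]|/= ->] //.
    by move: ta0; rewrite t1 dconst_comp => /esym/c0_neq_c1.
  by rewrite dconst_comp G01 -ta0 -snat.
have [|w [wu wv]] := rlp_prism pkan (u := SMap Fn) (v := S).
  move=> n [[x t] r] h; rewrite /= /F /=.
  case: (is_c0P t) h => [-> _|t0 [[|/= ->]|/= ->]] //; by rewrite ?pG0 ?pG1'.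
exists (scomp w (spair (sid _) (cst1 _ ord_max))); split=> [n x|n x|n x t] /=.
- have h : smem (prism_sub (ends A)) (n := n) ((x, c0), c1) by left; left.
  by rewrite (wu _ _ h).
- have h : smem (prism_sub (ends A)) (n := n) ((x, c1), c1) by left; right.
  by rewrite (wu _ _ h).
- by rewrite wv.
Qed.

End BoxFill.

(** Filling an open square makes one-step homotopy Euclidean; with reflexivity this gives symmetry
    and transitivity, so zigzags collapse. *)
Lemma kan_elem_homotopy (A K : sSet) (g h : smap A K) :
  kan_complex K -> homotopic g h -> elem_homotopy g h.
Proof.
move=> kK; have tr n (x y : Delta 0 n) : x = y.
  by apply: dmap_ext => s; rewrite !ord1.
have euclid (a b c : smap A K) :
    elem_homotopy a b -> elem_homotopy a c -> elem_homotopy c b.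
  move=> [G1 h1] [G0 h0].
  have [||||H [H0 H1 _]] := @box_fill _ _ _ kK A G0 G1 (to_pt _).
  - by move=> n x; rewrite (h0 n x).1 (h1 n x).1.
  - by move=> *; apply: tr.
  - by move=> *; apply: tr.
  - by move=> *; apply: tr.
  by exists H => n x; rewrite H0 H1 (h0 n x).2 (h1 n x).2.
have refl (a : smap A K) : elem_homotopy a a by exists (scomp a (sfst A I)).
elim=> [//|a|a b _ IH|a b c _ ab _ bc]; first exact: refl.
  exact: euclid (refl a) IH.
exact: euclid bc (euclid _ _ _ (refl a) ab).
Qed.

Lemma homotopic_comp (A B C : sSet) (g h : smap A B) (k : smap B C) :
  elem_homotopy g h -> elem_homotopy (scomp k g) (scomp k h).
Proof.
by move=> [H HE]; exists (scomp k H) => n x /=; rewrite (HE n x).1 (HE n x).2.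
Qed.

(** A connection on Delta^1: it spreads a homotopy over a square with two constant sides. *)
Definition dmap1_max m (t r : dmap m 1) : dmap m 1.
Proof.
apply: (@Dmap m 1 (fun s => if t s == ord0 then r s else t s)) => i j ij.
have := dmono t ij; have := dmono r ij; have := ltn_ord (r i).
by rewrite -!val_eqE /=; case: eqP => ti; case: eqP => tj; lia.
Defined.

Lemma dmap1_max_comp m n (t r : dmap n 1) (a : dmap m n) :
  dcomp (dmap1_max t r) a = dmap1_max (dcomp t a) (dcomp r a).
Proof. exact: dmap_ext. Qed.

Lemma dmap1_max0l m (t : dmap m 1) : dmap1_max c0 t = t.
Proof. exact: dmap_ext. Qed.

Lemma dmap1_max0r m (t : dmap m 1) : dmap1_max t c0 = t.
Proof. by apply: dmap_ext => s /=; case: eqP. Qed.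

Lemma dmap1_max1l m (t : dmap m 1) : dmap1_max c1 t = c1.
Proof. exact: dmap_ext. Qed.

Lemma dmap1_max1r m (t : dmap m 1) : dmap1_max t c1 = c1.
Proof. by apply: dmap_ext => s /=; case: eqP => // /eqP/ord2_neq0. Qed.

Section KanWeq.
Variables (E B : sSet) (p : smap E B).
Hypotheses (kE : kan_complex E) (kB : kan_complex B).
Hypotheses (kp : kan_fibration p) (wp : weq p).

Program Definition sempty (A : sSet) : ssub A := @SSub A (fun _ _ => False) _.
Next Obligation. by []. Qed.

Lemma path_lift (A : sSet) (h : smap A E) (H : smap (sprod A I) B) :
  (forall n x, p n (h n x) = H n (x, c0)) ->
  exists G : smap (sprod A I) E, (forall n x, G n (x, c0) = h n x) /\
    (forall n y, p n (G n y) = H n y).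
Proof.
move=> ph.
have [|G [Gu Gv]] := rlp_prism kp (M := sempty A)
  (u := scomp h (scomp (sfst A I) (sincl (prism_sub (sempty A))))) (v := H).
  by move=> n [x t] [[]|/= ->]; rewrite -ph.
exists G; split=> // n x.
have hx : smem (prism_sub (sempty A)) (n := n) (x, c0) by right.
by rewrite (Gu _ _ hx).
Qed.

(** Testing against [E] gives [h] with [h p] homotopic to the identity; testing against [B] then
    makes [p h] homotopic to the identity. Lifting the second homotopy replaces [h] by a strict
    section [s], and an open square makes the homotopy from [s p] to the identity fibrewise. *)
Lemma kan_weq_retraction : exists (s : smap B E) (H : smap (sprod E I) E),
  [/\ forall n b, p n (s n b) = b,
      forall n x, H n (x, c0) = s n (p n x),
      forall n x, H n (x, c1) = x
    & forall n x t, p n (H n (x, t)) = p n x].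
Proof.
have [h hp] := (wp kE).2 (sid E).
have {}hp := kan_elem_homotopy kE hp.
have ph : elem_homotopy (scomp p h) (sid B).
  apply: kan_elem_homotopy => //; apply: (wp kB).1; apply: rst_step.
  exact: homotopic_comp p hp.
have [Hb HbE] := ph.
have [|Th [Th0 pTh]] := @path_lift B h Hb; first by move=> n x; rewrite (HbE n x).1.
pose s := at_end Th ord_max.
have ps n b : p n (s n b) = b by rewrite pTh (HbE n b).2.
have [G GE] := hp.
have spid : elem_homotopy (scomp s p) (sid E).
  have hE : homotopic (scomp s p) (sid E).
    apply: (rst_trans _ _ _ (scomp h p)); last exact: rst_step.
    apply: rst_sym; apply: rst_step.
    exists (scomp Th (spair (scomp p (sfst E I)) (ssnd E I))) => n x /=.
    by rewrite Th0.
  exact: kan_elem_homotopy hE.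
have [H HE] := spid.
(* The open square with left side s p H, bottom side H and degenerate right side
   lies over S(t, r) = p H(max(t, r)), whose top side is constant. *)
pose S0 n (y : sprod (sprod E I) I n) := p n (H n (y.1.1, dmap1_max y.1.2 y.2)).
have Sn m n (a : dmap m n) y : S0 m (sact a y) = sact a (S0 n y).
  by rewrite /S0 -!snat /= -dmap1_max_comp.
have [||||H' [H0 H1 pH]] := box_fill kp
  (G0 := scomp s (scomp p H)) (G1 := H) (S := SMap Sn).
- by move=> n x /=; rewrite !(HE n x).1 /= ps.
- by move=> n x r /=; rewrite ps /S0 /= dmap1_max0l.
- by move=> n x t /=; rewrite /S0 /= dmap1_max0r.
- by move=> n x r /=; rewrite /S0 /= dmap1_max1l.
exists s, H'; split=> // n x.
- by rewrite H0 /= (HE n x).2.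
- by rewrite H1 (HE n x).2.
- by move=> t; rewrite pH /= /S0 /= dmap1_max1r (HE n x).2.
Qed.

(** The map [s v] is a lift of [v] that agrees with [u] on [M] only up to the fibrewise homotopy
    [H]. Extending this homotopy from [M] to [L] over the constant homotopy of [v] and taking its
    end corrects [s v]. *)
Theorem kan_weq_rlp (L : sSet) (M : ssub L) : rlp p M.
Proof.
move=> u v uv; have [s [H [ps H0 H1 pH]]] := kan_weq_retraction.
pose F n (y : prism_sub M n) : E n :=
  match pselect (smem M (sval y).1) with
  | left h => H n (u n (exist _ _ h), (sval y).2)
  | right _ => s n (v n (sval y).1)
  end.
have FM n (y : prism_sub M n) (h : smem M (sval y).1) :
    F n y = H n (u n (exist _ _ h), (sval y).2).
  by rewrite /F; case: pselect => // h'; rewrite (Prop_irrelevance h h').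
have F0 n (y : prism_sub M n) : (sval y).2 = c0 -> F n y = s n (v n (sval y).1).
  by move=> e; rewrite /F; case: pselect => // h; rewrite e H0 uv.
have Fn m n (a : dmap m n) y : F m (sact a y) = sact a (F n y).
  have [h|e] : smem M (sval y).1 \/ (sval y).2 = c0 := svalP y.
    rewrite (FM _ y h) (FM _ (sact a y) (smem_act a h)) -snat /= -snat.
    by congr (H m (u m _, _)); apply: eq_exist.
  by rewrite !F0 /= ?e ?dconst_comp // -!snat.
have [|w [wu wv]] := rlp_prism kp (u := SMap Fn) (v := scomp v (sfst L I)).
  move=> n [l t] h /=; rewrite /F; case: pselect => /= h'.
    by rewrite pH uv.
  by rewrite ps.
exists (at_end w ord_max); split=> [n y h|n y] /=; last by rewrite wv.
have h' : smem (prism_sub M) (n := n) (y, c1) by left.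
by rewrite (wu _ _ h') /= (FM _ (exist _ (y, c1) h') h) H1.
Qed.

End KanWeq.

(** * Lifting problems for bisimplicial sets *)

Lemma dcomp_idl m n (a : dmap m n) : dcomp (did n) a = a.
Proof. exact: dmap_ext. Qed.

Lemma dcomp_idr m n (a : dmap m n) : dcomp a (did m) = a.
Proof. exact: dmap_ext. Qed.

Section Curry.
Variables (A L : sSet) (X : bsSet).

(** Maps out of [box A L] correspond both to maps from [L] to [ldiv A X] and to maps from [A] to
    [rdiv X L]. Through them column-wise and row-wise lifting become one problem. *)
Program Definition curryl_at (b : bmap (box A L) X) n (l : L n) : ldiv A X n :=
  @BMap (box A (Delta n)) X (fun m q z => b m q (z.1, sact (z.2 : dmap q n) l)) _.
Next Obligation.
move=> b n l m m' q q' a c [x d] /=.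
by rewrite -(bnat b a c (x, sact (d : dmap q' n) l)) /= sact_comp.
Qed.

Definition curryl (b : bmap (box A L) X) : smap L (ldiv A X).
Proof.
apply: (@SMap L (ldiv A X) (curryl_at b)) => m n a l.
by apply: bmap_ext => p q [x d] /=; rewrite sact_comp.
Defined.

Definition uncurryl (w : smap L (ldiv A X)) : bmap (box A L) X.
Proof.
apply: (@BMap (box A L) X (fun m n z => (w n z.2 : bmap _ _) m n (z.1, did n))).
move=> m m' n n' a c [x l] /=.
rewrite (snat w) /= -(bnat (w n' l) a c (x, did n')) /=.
by congr (bfun (w n' l) (_, _)); rewrite dcomp_idl dcomp_idr.
Defined.

Program Definition curryr_at (b : bmap (box A L) X) n (x : A n) : rdiv X L n :=
  @BMap (box (Delta n) L) X (fun m q z => b m q (sact (z.1 : dmap m n) x, z.2)) _.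
Next Obligation.
move=> b n x m m' q q' a c [d l] /=.
by rewrite -(bnat b a c (sact (d : dmap m' n) x, l)) /= sact_comp.
Qed.

Definition curryr (b : bmap (box A L) X) : smap A (rdiv X L).
Proof.
apply: (@SMap A (rdiv X L) (curryr_at b)) => m n a l.
by apply: bmap_ext => p q [x d] /=; rewrite sact_comp.
Defined.

Definition uncurryr (w : smap A (rdiv X L)) : bmap (box A L) X.
Proof.
apply: (@BMap (box A L) X (fun m n z => (w m z.1 : bmap _ _) m n (did m, z.2))).
move=> m m' n n' a c [x l] /=.
rewrite (snat w) /= -(bnat (w m' x) a c (did m', l)) /=.
by congr (bfun (w m' x) (_, _)); rewrite dcomp_idl dcomp_idr.
Defined.

Lemma uncurrylE (w : smap L (ldiv A X)) n (l : L n) m q (x : A m) (d : dmap q n) :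
  (w n l : bmap _ _) m q (x, d) = uncurryl w m q (x, sact d l).
Proof. by rewrite /= snat /= dcomp_idr. Qed.

Lemma uncurryrE (w : smap A (rdiv X L)) n (x : A n) m q (d : dmap m n) (l : L q) :
  (w n x : bmap _ _) m q (d, l) = uncurryr w m q (sact d x, l).
Proof. by rewrite /= snat /= dcomp_idr. Qed.

End Curry.

Section BoxLift.
Variables (X Y : bsSet) (f : bmap X Y).

(** Lifting [f] against the pushout product of [u] and [v] for the box, with the map on the pushout
    given by its two legs. The leg [b] is a parameter so that it can be constrained later. *)
Definition box_lift_at (P Z M L : sSet) (u : smap P Z) (v : smap M L)
    (b : bmap (box P L) X) : Prop :=
  forall (a : bmap (box Z M) X) (c : bmap (box Z L) Y),
  (forall m n x l, a m n (u m x, l) = b m n (x, v n l)) ->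
  (forall m n z l, f m n (a m n (z, l)) = c m n (z, v n l)) ->
  (forall m n x l, f m n (b m n (x, l)) = c m n (u m x, l)) ->
  exists d : bmap (box Z L) X,
    [/\ forall m n z l, d m n (z, v n l) = a m n (z, l),
        forall m n x l, d m n (u m x, l) = b m n (x, l)
      & forall m n z l, f m n (d m n (z, l)) = c m n (z, l)].

Definition box_lift P Z M L (u : smap P Z) (v : smap M L) : Prop :=
  forall b, box_lift_at u v b.

Lemma ldiv_box_lift P Z M L (u : smap P Z) (v : smap M L) :
  lifts v (ldiv_gap u f) -> box_lift u v.
Proof.
move=> H b a c ab ac bc.
have h n l : ldivr P f n (curryl b n l) = ldivl u Y n (curryl c n l).
  by apply: bmap_ext => m q [x d] /=; apply: bc.
have [|w wu wv] := H (curryl a) (pb_pair h).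
  apply: smap_ext => n l; apply: eq_exist; congr pair.
    by apply: bmap_ext => m q [x d] /=; rewrite ab snat.
  by apply: bmap_ext => m q [x d] /=; rewrite ac snat.
exists (uncurryl w); split=> [m n z l|m n x l|m n z l] /=.
- have := congr1 (fun t : ldiv Z X n => (t : bmap _ _) m n (z, did n)) (smap_app l wu).
  by move=> /= ->; rewrite sact_id.
- have := congr1 (fun t : pb (ldivr P f) (ldivl u Y) n =>
    ((sval t).1 : bmap (box P (Delta n)) X) m n (x, did n)) (smap_app l wv).
  by move=> /= ->; rewrite sact_id.
- have := congr1 (fun t : pb (ldivr P f) (ldivl u Y) n =>
    ((sval t).2 : bmap (box Z (Delta n)) Y) m n (z, did n)) (smap_app l wv).
  by move=> /= ->; rewrite sact_id.
Qed.

Hypothesis fR : reedy_fibration f.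

Lemma reedy_box_horn P Z (u : smap P Z) n (k : 'I_n.+1) :
  smono u -> 0 < n -> box_lift u (sincl (horn k)).
Proof. by move=> um n0; apply/ldiv_box_lift/fR. Qed.

Lemma reedy_box_prism P Z (u : smap P Z) L (M : ssub L) :
  smono u -> box_lift u (sincl (prism_sub M)).
Proof. by move=> um; apply/ldiv_box_lift/rlpP/rlp_prism/fR. Qed.

End BoxLift.

Lemma box_natr (X : bsSet) (A L : sSet) (b : bmap (box A L) X) m n n'
    (c : dmap n n') (x : A m) (l : L n') :
  b m n (x, sact c l) = bact (did m) c (b m n' (x, l)).
Proof. by rewrite -bnat /= sact_id. Qed.

Lemma box_natl (X : bsSet) (A L : sSet) (b : bmap (box A L) X) m m' n
    (a : dmap m m') (x : A m') (l : L n) :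
  b m n (sact a x, l) = bact a (did n) (b m' n (x, l)).
Proof. by rewrite -bnat /= sact_id. Qed.

(** Naturality in [L] is left out on purpose: [glue] then applies in the first variable alone, and
    naturality of the glued map in [L] is checked afterwards. *)
Definition fam (X : bsSet) (L : sSet) : sSet.
Proof.
apply: (@SSet (fun m => forall n, L n -> X m n)
  (fun m m' a t n l => bact a (did n) (t n l))).
- move=> m t; apply: functional_extensionality_dep => n; apply/funext => l.
  exact: bact_id.
- move=> m m' m'' b a t; apply: functional_extensionality_dep => n.
  by apply/funext => l; rewrite -bact_comp dcomp_idl.
Defined.

Definition to_fam (X : bsSet) (A L : sSet) (b : bmap (box A L) X) :
  smap A (fam X L).
Proof.
apply: (@SMap A (fam X L) (fun m x n l => b m n (x, l))) => m m' a x.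
apply: functional_extensionality_dep => n; apply/funext => l /=.
exact: box_natl.
Defined.

Lemma bglue (X : bsSet) (Z D L : sSet) (P Q : ssub Z) (x : smap D Z)
    (u : bmap (box P L) X) (w : bmap (box D L) X) :
  (forall n (y : Z n), smem Q y -> smem P y \/ exists d, y = x n d) ->
  (forall m n d l (h : smem P (x m d)), w m n (d, l) = u m n (exist _ _ h, l)) ->
  (forall m n d d' l, x m d = x m d' -> w m n (d, l) = w m n (d', l)) ->
  exists W : bmap (box Q L) X,
    (forall m n y l (hQ : smem Q y) (hP : smem P y),
       W m n (exist _ y hQ, l) = u m n (exist _ y hP, l)) /\
    (forall m n d l (hQ : smem Q (x m d)), W m n (exist _ _ hQ, l) = w m n (d, l)).
Proof.
move=> cover uw ww.
have [||W [WP WD]] := @glue Z D (fam X L) P Q x cover (to_fam u) (to_fam w).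
- move=> m d h; apply: functional_extensionality_dep => n; apply/funext => l.
  exact: uw.
- move=> m d d' e; apply: functional_extensionality_dep => n; apply/funext => l.
  exact: ww.
have Wn m m' n n' (a : dmap m m') (c : dmap n n') (z : box Q L m' n') :
    W m (sact a z.1) n (sact c z.2) = bact a c (W m' z.1 n' z.2).
  case: z => [q l]; rewrite (snat W a q) /=.
  have bE (t : X m' n') : bact a c t = bact a (did n) (bact (did m') c t).
    by rewrite -bact_comp dcomp_idl dcomp_idr.
  rewrite bE; congr bact; case: q => [y hy]; case: (cover _ _ hy) => [h|[d e]].
    by rewrite !(WP _ _ _ h) /= box_natr.
  move: hy; rewrite e => hy; rewrite !WD /=.
  by rewrite box_natr.
exists (@BMap (box Q L) X (fun m n z => W m z.1 n z.2) Wn).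
split=> [m n y l hQ hP|m n d l hQ] /=; first by rewrite (WP _ _ hQ hP).
by rewrite WD.
Qed.

(** The pushout product of [M -> L] with the boundary of Delta^1: extending from it means finding a
    homotopy relative to [M] between two given maps. *)
Program Definition slice_sub (L : sSet) (M : ssub L) : ssub (sprod L I) :=
  @SSub (sprod L I) (fun n y => [\/ smem M y.1, y.2 = c0 | y.2 = c1]) _.
Next Obligation.
move=> L M m n a [l t] /= [h|->|->]; rewrite ?dconst_comp.
- by constructor 1; apply: smem_act.
- by constructor 2.
- by constructor 3.
Qed.

Lemma is_c1P m (t : dmap m 1) : reflect (t = c1) (t ord0 != ord0).
Proof.
apply: (iffP idP) => [t1|->] //; apply: dmap_ext => s.
apply: ord2_neq0; move: t1; apply: contra_neq => e; apply: val_inj; apply/eqP.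
by rewrite /= -leqn0; have := dmono t (leq0n s : @ord0 m <= s); rewrite e.
Qed.

Definition bpr (X : bsSet) (A L : sSet) (b : bmap (box A L) X) :
    bmap (box A (sprod L I)) X :=
  bcomp b (boxmap (sid A) (sfst L I)).

Lemma slice_map (X : bsSet) (Z L : sSet) (M : ssub L) (d0 d1 : bmap (box Z L) X) :
  (forall m n z l, smem M l -> d0 m n (z, l) = d1 m n (z, l)) ->
  exists a : bmap (box Z (slice_sub M)) X,
    (forall m n z l t h, (t = c1 -> False) -> a m n (z, exist _ (l, t) h) = d0 m n (z, l)) /\
    (forall m n z l h, a m n (z, exist _ (l, c1) h) = d1 m n (z, l)).
Proof.
move=> d01.
(* Away from both ends the simplex lies in [M], where [d0] and [d1] agree. *)
pose F m n (y : box Z (slice_sub M) m n) : X m n :=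
  if (sval y.2).2 ord0 != ord0 then d1 m n (y.1, (sval y.2).1)
  else d0 m n (y.1, (sval y.2).1).
have Fn m m' n n' (a : dmap m m') (c : dmap n n') (y : box Z (slice_sub M) m' n') :
    F m n (bact a c y) = bact a c (F m' n' y).
  case: y => z [[l t] h]; rewrite /F /=.
  case: (is_c1P t) => [->|t1].
    by rewrite /= -(bnat d1 a c (z, l)).
  case: ifP => [/(is_c1P (dcomp t c)) tc|_]; last by rewrite -(bnat d0 a c (z, l)).
  rewrite -(bnat d0 a c (z, l)) /= d01 //; apply: smem_act.
  by case: h => //= t0; case: (@c0_neq_c1 n); rewrite -tc t0 dconst_comp.
exists (BMap Fn); split=> [m n z l t h t1|m n z l h] /=; rewrite /F //=.
by case: is_c1P.
Qed.

(** * Marked trivial fibrations and their closure properties *)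

Section Tf.
Variables (X Y : bsSet) (f : bmap X Y).

(** Marked edges must go to [e] constantly along [L]. This expresses problems in the fibres over [e]
    without forming the fibres. *)
Definition marked (Z : sSet) (mk : Z 1 -> X 1 0 -> Prop) (P L : sSet)
    (u : smap P Z) (b : bmap (box P L) X) : Prop :=
  forall s e, mk (u 1 s) e ->
  forall n l, b 1 n (s, l) = bact (did 1) (dconst n ord0) e.

(* The marked form of: <u \ f> is a trivial fibration. *)
Definition tf (Z : sSet) (mk : Z 1 -> X 1 0 -> Prop) (P : ssub Z) : Prop :=
  forall (L : sSet) (M : ssub L) (b : bmap (box P L) X),
  marked mk (sincl P) b -> box_lift_at f (sincl P) (sincl M) b.

Lemma tf_weaken (Z : sSet) (mk mk' : Z 1 -> X 1 0 -> Prop) (P : ssub Z) :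
  (forall s e, mk' s e -> mk s e) -> tf mk' P -> tf mk P.
Proof. by move=> mm H L M b bm; apply: H => s e /mm; apply: bm. Qed.

Lemma tf_full (Z : sSet) mk (P : ssub Z) : (forall n (z : Z n), smem P z) -> tf mk P.
Proof.
move=> Pt L M b _ a c ab ac bc.
have dn m m' n n' (a' : dmap m m') (c' : dmap n n') (z : box Z L m' n') :
    b m n (exist _ (sact a' z.1) (Pt _ _), sact c' z.2)
    = bact a' c' (b m' n' (exist _ z.1 (Pt _ _), z.2)).
  by rewrite -bnat; congr (b m n (_, _)); apply: eq_exist.
exists (@BMap (box Z L) X (fun m n z => b m n (exist _ z.1 (Pt _ _), z.2)) dn).
split=> [m n z l|m n [x h] l|m n z l] /=.
- by rewrite -ab.
- by rewrite (Prop_irrelevance (Pt m x) h).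
- by rewrite bc.
Qed.

Hypothesis fR : reedy_fibration f.

(* Right cancellation against a pushout: a lift d0 that is correct on P
   differs on D from the prescribed one by a homotopy relative to M and P
   (lift against D), and this homotopy extends to Z because f is Reedy. *)
Lemma tf_attach (Z D : sSet) (mk : Z 1 -> X 1 0 -> Prop)
    (mkD : D 1 -> X 1 0 -> Prop) (P Q : ssub Z) (x : smap D Z) :
  (forall n (y : Z n), smem P y -> smem Q y) ->
  (forall n (y : Z n), smem Q y <-> smem P y \/ exists d, y = x n d) ->
  smono x ->
  (forall s e, mkD s e -> mk (x 1 s) e) ->
  tf mk P -> tf mkD (spre x P) -> tf mk Q.
Proof.
move=> PQ Qcov xI mkx tP tD L M b bm a c ab ac bc.
have QD n d : smem Q (x n d) by apply/Qcov; right; exists d.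
pose PtoQ : smap P Q := @SMap P Q (fun n y => exist _ (sval y) (PQ _ _ (svalP y)))
  (fun m n a y => eq_exist _ _ (erefl (sact a (sval y)))).
pose DtoQ : smap D Q := @SMap D Q (fun n d => exist _ (x n d) (QD n d))
  (fun m n a d => eq_exist _ _ (snat x a d)).
pose bP := bcomp b (boxmap PtoQ (sid L)).
have [|m n [y h] l|//|m n y l|d0 [d0M d0P d0f]] := tP L M bP _ a c.
- by move=> s e /(bm (PtoQ 1 s)).
- by rewrite /= -ab.
- by rewrite /= bc.
have {}d0P m n y l (hP : smem P y) (hQ : smem Q y) :
    d0 m n (y, l) = b m n (exist _ y hQ, l).
  by have /= -> := d0P m n (exist _ y hP) l; congr (b m n (_, l)); apply: eq_exist.
pose bD := bcomp b (boxmap DtoQ (sid L)).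
have [|aD [aD0 aD1]] :=
    @slice_map X D L M (bcomp d0 (boxmap x (sid L))) bD.
  by move=> m n z l h /=; have /= -> := d0M m n (x m z) (exist _ l h);
    apply: (ab m n (DtoQ m z) (exist _ l h)).
have aDE m n z l t h : smem M l \/ t = c0 -> aD m n (z, exist _ (l, t) h) = d0 m n (x m z, l).
  case: (is_c1P t) h => [->|t1] h; last by move=> _; rewrite aD0.
  case=> [hl|/esym/c0_neq_c1 //]; rewrite aD1 /=.
  have /= -> := d0M m n (x m z) (exist _ l hl).
  by rewrite (ab m n (DtoQ m z) (exist _ l hl)).
pose PtoQx := scomp PtoQ (sprem x P).
(* As [tf] ranges over all [L] and [M], the homotopy from [d0] to the prescribed map is one more
   instance of it. *)
have [||||hD [hDM hDP hDf]] := tD (sprod L I) (slice_sub M)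
    (bpr (bcomp b (boxmap PtoQx (sid L)))) _ aD (bpr (bcomp c (boxmap x (sid L)))).
- by move=> s e /mkx h n l /=; apply: bm.
- move=> m n [d h] [[l t] ht] /=; case: (is_c1P t) ht => [->|t1] ht.
    by rewrite aD1 /=; congr (b m n (_, l)); apply: eq_exist.
  by rewrite aD0 //= (d0P _ _ _ _ h (QD m d)); congr (b m n (_, l)); apply: eq_exist.
- move=> m n d [[l t] ht] /=; case: (is_c1P t) ht => [->|t1] ht.
    by rewrite aD1 /= bc.
  by rewrite aD0 //= d0f.
- by move=> m n [d h] [l t] /=; rewrite bc.
have [|||eta [etaP etaD]] := @bglue X Z D (sprod L I) P Q x (bpr bP) hD.
- by move=> n y; rewrite Qcov.
- move=> m n d l h; have /= -> := hDP m n (exist _ d h) l.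
  by congr (b m n (_, _)); apply: eq_exist.
- by move=> m n d d' l /xI ->.
have [|||Xi [XiM XiQ Xif]] := reedy_box_prism fR (M := M) (@sincl_mono _ Q) (b := eta)
  (a := bcomp d0 (boxmap (sid Z) (scomp (sfst L I) (sincl (prism_sub M))))) (c := bpr c).
- move=> m n [y hQ] [[l t] ht] /=; case: (Qcov _ y).1 => // [hP|[d e]].
    rewrite (etaP _ _ _ _ hQ hP) /= (d0P _ _ _ _ hP hQ).
    by congr (b m n (_, l)); apply: eq_exist.
  subst y; rewrite etaD; have hs : smem (slice_sub M) (n := n) (l, t).
    by case: ht => h; [constructor 1|constructor 2].
  by have /= -> := hDM m n d (exist _ (l, t) hs); rewrite aDE.
- by move=> m n z [[l t] ht] /=; rewrite d0f.
- move=> m n [y hQ] [l t] /=; case: (Qcov _ y).1 => // [hP|[d e]].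
    by rewrite (etaP _ _ _ _ hQ hP) /= bc.
  by subst y; rewrite etaD hDf.
exists (bcomp Xi (boxmap (sid Z) (spair (sid L) (cst1 L ord_max)))).
split=> [m n z [l h]|m n [y hQ] l|m n z l] /=.
- have h' : smem (prism_sub M) (n := n) (l, c1) by left.
  by have /= -> := XiM m n z (exist _ (l, c1) h'); have /= -> := d0M m n z (exist _ l h).
- have /= -> := XiQ m n (exist _ y hQ) (l, c1).
  case: (Qcov _ y).1 => // [hP|[d e]].
    by rewrite (etaP _ _ _ _ hQ hP) /=; congr (b m n (_, l)); apply: eq_exist.
  subst y; rewrite etaD; have hs : smem (slice_sub M) (n := n) (l, c1) by constructor 3.
  have /= -> := hDM m n d (exist _ (l, c1) hs).
  by rewrite aD1 /=; congr (b m n (_, l)); apply: eq_exist.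
- by rewrite Xif.
Qed.

End Tf.

Definition unmarked (X : bsSet) (Z : sSet) : Z 1 -> X 1 0 -> Prop :=
  fun _ _ => False.

(** A lift [d0] found in [X] alone need not lie over [c]. But [f d0] and [c] extend the same data in
    [Y], so they are homotopic relative to it, and this homotopy lifts to [X] because [f] is
    Reedy. *)
Lemma tf_total (X Y : bsSet) (f : bmap X Y) (Z : sSet) (P : ssub Z) :
  reedy_fibration f ->
  tf (to_bpt X) (@unmarked X Z) P -> tf (to_bpt Y) (@unmarked Y Z) P ->
  tf f (@unmarked X Z) P.
Proof.
move=> fR tX tY L M b _ a c ab ac bc.
have [|//|//|//|d0 [d0M d0P _]] := tX L M b _ a (to_bpt _); first by [].
have [|aY [aY0 aY1]] := @slice_map Y Z L M (bcomp f d0) c.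
  by move=> m n z l h /=; have /= -> := d0M m n z (exist _ l h);
    apply: (ac m n z (exist _ l h)).
have aYE m n z l t h : smem M l \/ t = c0 ->
    aY m n (z, exist _ (l, t) h) = f m n (d0 m n (z, l)).
  case: (is_c1P t) h => [->|t1] h; last by move=> _; rewrite aY0.
  case=> [hl|/esym/c0_neq_c1 //]; rewrite aY1.
  have /= -> := d0M m n z (exist _ l hl).
  by rewrite (ac m n z (exist _ l hl)).
have [||//|//|hY [hYM hYP _]] := tY (sprod L I) (slice_sub M)
    (bpr (bcomp f b)) _ aY (to_bpt _); first by [].
  move=> m n p [[l t] ht] /=; case: (is_c1P t) ht => [->|t1] ht.
    by rewrite aY1 bc.
  by rewrite aY0 //=; have /= -> := d0P m n p l.
have [|||Xi [XiM XiP Xif]] := reedy_box_prism fR (M := M) (@sincl_mono _ P) (b := bpr b)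
  (a := bcomp d0 (boxmap (sid Z) (scomp (sfst L I) (sincl (prism_sub M))))) (c := hY).
- by move=> m n p [[l t] ht] /=; have /= -> := d0P m n p l.
- move=> m n z [[l t] ht] /=; have hs : smem (slice_sub M) (n := n) (l, t).
    by case: ht => h; [constructor 1|constructor 2].
  by have /= -> := hYM m n z (exist _ (l, t) hs); rewrite aYE.
- by move=> m n p [l t] /=; rewrite hYP.
exists (bcomp Xi (boxmap (sid Z) (spair (sid L) (cst1 L ord_max)))).
split=> [m n z [l h]|m n p l|m n z l] /=.
- have h' : smem (prism_sub M) (n := n) (l, c1) by left.
  by have /= -> := XiM m n z (exist _ (l, c1) h'); have /= -> := d0M m n z (exist _ l h).
- exact: (XiP m n p (l, c1)).
- rewrite Xif; have hs : smem (slice_sub M) (n := n) (l, c1) by constructor 3.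
  by have /= -> := hYM m n z (exist _ (l, c1) hs); rewrite aY1.
Qed.

(** * Attaching faces *)

Program Definition faces n (T : pred 'I_n.+1) : ssub (Delta n) :=
  @SSub (Delta n) (fun m a => exists2 i, T i & forall j, a j <> i) _.
Next Obligation. by move=> n T m p a x [i Ti hi] /=; exists i => // j; apply: hi. Qed.

Program Definition add_face n (P : ssub (Delta n)) (i : 'I_n.+1) : ssub (Delta n) :=
  @SSub (Delta n) (fun m a => smem P a \/ forall j, a j <> i) _.
Next Obligation.
move=> n P i m p a x [h|h] /=; first by left; apply: (smem_act (s := P)).
by right => j; apply: h.
Qed.

Local Notation face_map i := (Deltamap (dlift i)).

Lemma face_map_mono n (i : 'I_n.+2) : smono (face_map i).
Proof.
move=> m a b e; apply: dmap_ext => s; apply: (@lift_inj _ i).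
exact: (congr1 (fun c : dmap m n.+1 => c s) e).
Qed.

Lemma horn_faces n (k : 'I_n.+1) : horn k = faces (predC1 k).
Proof. by apply: ssub_ext => m a; split=> -[i /eqP ik hi]; exists i => //; apply/eqP. Qed.

Lemma add_face_faces n (T : pred 'I_n.+1) j :
  add_face (faces T) j = faces (predU1 j T).
Proof.
apply: ssub_ext => m a; split=> [[[i Ti hi]|hj]|[i /predU1P[->|Ti] hi]].
- by exists i => //; apply/predU1P; right.
- by exists j => //; apply: predU1l.
- by right.
- by left; exists i.
Qed.

Lemma face_map_faces n (T : pred 'I_n.+2) j : ~~ T j ->
  spre (face_map j) (faces T) = faces (fun i => T (lift j i)).
Proof.
move=> Tj; apply: ssub_ext => m a; split=> /= -[i Ti hi].
  case: (unliftP j i) Ti hi => [k ->|->] Ti hi; last by rewrite Ti in Tj.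
  by exists k => // s e; apply: (hi s); rewrite /= e.
by exists (lift j i) => // s /lift_inj; apply: hi.
Qed.

Section FaceTf.
Variables (X Y : bsSet) (f : bmap X Y).
Hypothesis fR : reedy_fibration f.

Lemma tf_add_face n (j : 'I_n.+2) (mk : Delta n.+1 1 -> X 1 0 -> Prop)
    (mkD : Delta n 1 -> X 1 0 -> Prop) (P : ssub (Delta n.+1)) :
  (forall s e, mkD s e -> mk (dcomp (dlift j) s) e) ->
  tf f mk P -> tf f mkD (spre (face_map j) P) -> tf f mk (add_face P j).
Proof.
move=> mm tP tD; apply: (tf_attach fR _ _ (@face_map_mono n j) mm tP tD).
  by move=> m y h; left.
move=> m y; split=> [[h|h]|[h|[d ->]]]; [by left|right|by left|right].
  by have [b ->] := dlift_factor h; exists b.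
by move=> s; apply: dlift_neq.
Qed.

(** The faces are attached in the arbitrary order of [enum T]; hence the last hypothesis covers
    every intermediate set [T1]. *)
Lemma tf_faces n (T0 T : pred 'I_n.+2) (mk : Delta n.+1 1 -> X 1 0 -> Prop)
    (mkD : Delta n 1 -> X 1 0 -> Prop) :
  {subset T0 <= T} -> tf f mk (faces T0) ->
  (forall j, T j -> ~~ T0 j -> forall s e, mkD s e -> mk (dcomp (dlift j) s) e) ->
  (forall j (T1 : pred 'I_n.+2), T j -> ~~ T1 j ->
     {subset T0 <= T1} -> {subset T1 <= T} ->
     tf f mkD (faces (fun i => T1 (lift j i)))) ->
  tf f mk (faces T).
Proof.
move=> T0T t0 mm IH.
pose Ts (s : seq 'I_n.+2) : pred 'I_n.+2 := fun i => T0 i || (i \in s).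
have ts s : {subset s <= T} -> tf f mk (faces (Ts s)).
  elim: s => [_|j s IHs sT].
    by rewrite (_ : Ts [::] = T0) //; apply/funext => i; rewrite /Ts orbF.
  have sT' : {subset s <= T} by move=> i h; apply: sT; rewrite inE h orbT.
  have e : Ts (j :: s) = predU1 j (Ts s).
    by apply/funext => i; rewrite /Ts /= inE orbCA.
  case: (boolP (Ts s j)) => Tj.
    rewrite (_ : Ts (j :: s) = Ts s); first exact: IHs.
    by rewrite e; apply/funext => i /=; case: eqP => // ->.
  have jT : T j by apply: sT; rewrite inE eqxx.
  rewrite e -add_face_faces; apply: (@tf_add_face _ j mk mkD).
  - by apply: mm => //; move: Tj; rewrite negb_or => /andP[].
  - exact: IHs.
  rewrite face_map_faces //; apply: IH => // i; rewrite !unfold_in /Ts.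
    by move=> ->.
  by case/orP => [/T0T|/sT'].
rewrite (_ : T = Ts (enum T)); first by apply: ts => i; rewrite mem_enum.
apply/funext => i; rewrite /Ts mem_enum [i \in T]unfold_in.
by case: (boolP (T0 i)) => // /T0T.
Qed.

Hypothesis spine_tf : forall n, 1 < n -> tf f (@unmarked X (Delta n)) (spine n).

Lemma tf_spine n : tf f (@unmarked X (Delta n.+1)) (spine n.+1).
Proof.
case: n => [|n]; last exact: spine_tf.
apply: tf_full => m a; exists ord0 => j.
by case: (a j) => [[|[|]]] //= _; [left|right].
Qed.

(** The face opposite the last vertex meets the spine in its own spine. *)
Lemma tf_spine_last n :
  tf f (@unmarked X (Delta n.+2)) (add_face (spine n.+2) ord_max).
Proof.
apply: (@tf_add_face _ _ _ (@unmarked X (Delta n.+1))) => //; first exact: tf_spine.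
rewrite (_ : spre _ _ = spine n.+1); first exact: tf_spine.
apply: ssub_ext => m a; split=> /= -[i hi].
  case: (ltnP i n.+1) => hin.
    exists (Ordinal hin) => j; case: (hi j) => /=; rewrite /bump /=;
      have := ltn_ord (a j); lia.
  exists ord_max => j; have := ltn_ord (a j); have := ltn_ord i.
  by case: (hi j) => /=; rewrite /bump /=; lia.
exists (widen_ord (leqnSn _) i) => j; have := ltn_ord (a j).
by case: (hi j) => /=; rewrite /bump /=; lia.
Qed.

(** The two faces contain the spine. The face opposite 0 meets the spine and the last face in its
    own spine and its own last face. *)
Lemma tf_faces_0max n : tf f (@unmarked X (Delta n.+2))
  (faces [pred i | (i == ord0) || (i == ord_max)]).
Proof.
rewrite (_ : faces _ = add_face (add_face (spine n.+2) ord_max) ord0).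
  apply: (@tf_add_face _ _ _ (@unmarked X (Delta n.+1))) => //.
    exact: tf_spine_last.
  (* In Delta^2 the face opposite 0 is itself an edge of the spine. *)
  case: n => [|n].
    apply: tf_full => m a; left; exists ord_max => j /=; rewrite /bump /=.
    by have := ltn_ord (a j); lia.
  rewrite (_ : spre _ _ = add_face (spine n.+2) ord_max); first exact: tf_spine_last.
  apply: ssub_ext => m a; split=> /= -[[i hi]|h].
  - left; case: (unliftP ord0 i) hi => [k ->|->] hi; last first.
      exists ord0 => j; have := ltn_ord (a j).
      by case: (hi j) => /=; rewrite /bump /=; lia.
    exists k => j; have := ltn_ord (a j).
    by case: (hi j) => /=; rewrite /bump /=; lia.
  - right=> j e; apply: (h j); apply: val_inj => /=.
    by rewrite e /bump /=; lia.
  - left; exists (lift ord0 i) => j.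
    by case: (hi j) => /=; rewrite /bump /=; lia.
  - right=> j /(congr1 val) /= e; apply: (h j); apply: val_inj => /=.
    by move: e; rewrite /bump /=; lia.
apply: ssub_ext => m a; split.
  case=> i /orP[/eqP ->|/eqP ->] hi; first by right.
  by left; right.
case=> [[[i hi]|h]|h].
- case: (ltnP i n.+1) => hin.
    exists ord_max; first by rewrite /= eqxx ?orbT.
    by move=> j /(congr1 val) /=; case: (hi j) => ->; lia.
  exists ord0 => // j /(congr1 val) /=; case: (hi j) => ->; lia.
- by exists ord_max => //; rewrite /= eqxx ?orbT.
- by exists ord0.
Qed.

Lemma lift_ord0 n (j : 'I_n.+2) : j != ord0 -> lift j ord0 = ord0.
Proof. by rewrite -val_eqE /= => h; apply: val_inj; rewrite /= /bump; lia. Qed.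

Lemma lift_ord_max n (j : 'I_n.+2) : j != ord_max -> lift j ord_max = ord_max.
Proof.
rewrite -val_eqE /= => h; apply: val_inj; rewrite /= /bump.
by have := ltn_ord j; lia.
Qed.

(** Sets of faces that contain both extreme ones and omit some [k] are stable under the induction,
    whereas inner horns alone are not. *)
Lemma tf_inner_faces n (T : pred 'I_n.+1) k :
  T ord0 -> T ord_max -> ~~ T k -> tf f (@unmarked X (Delta n)) (faces T).
Proof.
elim: n T k => [|n IH] T k T0 Tm Tk; first by rewrite ord1 T0 in Tk.
case: n IH T k T0 Tm Tk => [|n] IH T k T0 Tm Tk.
  case: (unliftP ord0 k) Tk => [l ->|->]; last by rewrite T0.
  rewrite (_ : lift ord0 l = ord_max) ?Tm //.
  by apply: val_inj; rewrite ord1.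
apply: (@tf_faces _ [pred i | (i == ord0) || (i == ord_max)] T _ (@unmarked X _)) => //.
- by move=> i /orP[/eqP ->|/eqP ->].
- exact: tf_faces_0max.
move=> j T1 Tj T1j s1 s2.
have k1 : ~~ T1 k by apply: contra Tk => /s2.
case: (unliftP j k) Tk k1 => [l -> _ k1|->]; last by rewrite Tj.
have j0 : j != ord0 by apply: contraNneq T1j => ->; apply: s1; rewrite inE eqxx.
have jm : j != ord_max.
  by apply: contraNneq T1j => ->; apply: s1; rewrite inE eqxx ?orbT.
apply: (IH _ l) => //; rewrite ?lift_ord0 ?lift_ord_max //; apply: s1.
  by rewrite inE eqxx.
by rewrite inE eqxx ?orbT.
Qed.

Lemma tf_inner_horn n (k : 'I_n.+1) :
  0 < k < n -> tf f (@unmarked X (Delta n)) (horn k).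
Proof.
case/andP=> k0 kn; rewrite horn_faces; apply: (@tf_inner_faces _ _ k) => /=.
- by rewrite -val_eqE /=; lia.
- by rewrite -val_eqE /=; lia.
- by rewrite eqxx.
Qed.

(** From dimension 3 on, the last edge of the spine avoids the vertex 1, so these two faces contain
    the spine; the new spine edge {0,2} of the face opposite 1 lies in the last face. In dimension 2
    they would form the horn at 0, where cocartesianness must enter. *)
Lemma tf_faces_1max n : tf f (@unmarked X (Delta n.+3))
  (faces [pred i : 'I_n.+4 | (i == 1 :> nat) || (i == ord_max)]).
Proof.
pose o1 : 'I_n.+4 := lift ord0 ord0.
rewrite (_ : faces _ = add_face (add_face (spine n.+3) ord_max) o1).
  apply: (@tf_add_face _ _ _ (@unmarked X (Delta n.+2))) => //.
    exact: tf_spine_last.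
  rewrite (_ : spre _ _ = add_face (spine n.+2) ord_max); first exact: tf_spine_last.
  apply: ssub_ext => m a; split=> /= -[[i hi]|h].
  - case: (ltnP i n.+2) => hin.
      right=> j /(congr1 val) /= e.
      by case: (hi j) => /=; rewrite /bump /= e; lia.
    left; exists ord_max => j; have := ltn_ord i.
    by case: (hi j) => /=; rewrite /bump /=; lia.
  - right=> j e; apply: (h j); apply: val_inj => /=.
    by rewrite e /bump /=; lia.
  - case: (ltnP i n.+1) => hin.
      right=> j /(congr1 val) /=; rewrite /bump /=.
      by case: (hi j) => ->; lia.
    left; exists ord_max => j; have := ltn_ord i.
    by case: (hi j) => /=; rewrite /bump /=; lia.
  - right=> j /(congr1 val) /= e; apply: (h j); apply: val_inj => /=.
    by move: e; rewrite /bump /=; lia.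
apply: ssub_ext => m a; split.
  case=> i /orP[/eqP e|/eqP ->] hi; last by left; right.
  by right=> j e'; apply: (hi j); rewrite e'; apply: val_inj; rewrite /= e.
case=> [[[i hi]|h]|h].
- case: (ltnP i n.+2) => hin.
    exists ord_max; first by rewrite /= eqxx ?orbT.
    by move=> j /(congr1 val) /=; case: (hi j) => ->; lia.
  exists o1 => // j /(congr1 val) /=; rewrite /bump /=; case: (hi j) => ->; lia.
- by exists ord_max => //; rewrite /= eqxx ?orbT.
- by exists o1.
Qed.

Definition mark01 (e : X 1 0) n : Delta n.+1 1 -> X 1 0 -> Prop :=
  fun s e' => s = d01 n /\ e' = e.

Variable e : X 1 0.
Hypothesis horn2_tf : tf f (@mark01 e 1) (horn (n := 2) ord0).

(** Faces beyond the two initial ones are opposite some [j] other than 0 and 1. They contain the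
    edge {0,1}, so the mark restricts to them. *)
Lemma tf_outer_faces n (T : pred 'I_n.+3) :
  T (lift ord0 ord0) -> T ord_max -> ~~ T ord0 ->
  tf f (@mark01 e n.+1) (faces T).
Proof.
elim: n T => [|n IH] T T1 Tm T0.
  rewrite (_ : faces T = horn ord0) // horn_faces; congr faces.
  apply/funext => i /=; case: (unliftP ord0 i) => [k ->|->]; last first.
    by rewrite eqxx (negbTE T0).
  rewrite eq_sym (negbTE (neq_lift _ _)); case: (unliftP ord0 k) => [l ->|->] //.
  rewrite (_ : lift ord0 _ = ord_max) //.
  by apply: val_inj; rewrite ord1.
apply: (@tf_faces _ [pred i : 'I_n.+4 | (i == 1 :> nat) || (i == ord_max)] T _
  (@mark01 e n.+1)) => //.
- move=> i /orP[/eqP h|/eqP ->] //.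
  by rewrite (_ : i = lift ord0 ord0) //; apply: val_inj.
- by apply: (@tf_weaken _ _ f _ _ _ _ _ (@tf_faces_1max n)) => s e' [].
- move=> j Tj nTj s e' [-> ->]; split=> //; apply: dmap_ext => i.
  apply: val_inj => /=; rewrite /bump; have := ltn_ord i.
  have j0 : j != ord0 by apply: contraNneq T0 => <-.
  by move: nTj j0; rewrite negb_or -[j == ord0]val_eqE /= => /andP[] /eqP ? _ /eqP ?; lia.
move=> j T' Tj T'j s1 s2.
have j0 : j != ord0 by apply: contraNneq T0 => <-.
have jm : j != ord_max.
  by apply: contraNneq T'j => ->; apply: s1; rewrite inE eqxx ?orbT.
have j1 : j != 1 :> nat.
  by apply: contraNN T'j => h; apply: s1; rewrite inE h.
apply: IH; rewrite ?(lift_ord0 j0) ?(lift_ord_max jm) //.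
- apply: s1; rewrite inE; apply/orP; left; apply/eqP => /=.
  by move: j0 j1; rewrite -[j == ord0]val_eqE /= /bump; lia.
- by apply: s1; rewrite inE eqxx ?orbT.
- by apply: contra T0 => /s2.
Qed.

Lemma tf_outer_horn n : tf f (@mark01 e n.+1) (horn (n := n.+2) ord0).
Proof. by rewrite horn_faces; apply: tf_outer_faces. Qed.

End FaceTf.

(** * The Segal condition and cocartesian morphisms *)

Lemma pt_eq n (x y : Delta 0 n) : x = y.
Proof. by apply: dmap_ext => s; rewrite !ord1. Qed.

Lemma unit_eq (x y : unit) : x = y. Proof. by case: x; case: y. Qed.

Lemma pb_eq (A B C : sSet) (g : smap A C) (h : smap B C) n (t t' : pb g h n) :
  pb_fst g h n t = pb_fst g h n t' -> pb_snd g h n t = pb_snd g h n t' -> t = t'.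
Proof.
by case: t t' => [[x y] hx] [[x' y'] hx'] /= ex ey; apply: eq_exist; congr pair.
Qed.

Lemma kan_complex_pb (A B C : sSet) (g : smap A C) (h : smap B C) :
  kan_complex A -> kan_fibration h -> kan_complex (pb g h).
Proof.
move=> kA kh n k n0; apply/rlpP => u v uv.
have [|x [xu _]] := (rlpP _ _).1 (kA n k n0) (scomp (pb_fst g h) u) (to_pt _).
  by move=> m y hy; apply: pt_eq.
have [|y [yu yv]] := (rlpP _ _).1 (kh n k n0) (scomp (pb_snd g h) u) (scomp g x).
  by move=> m y hy /=; rewrite (xu _ _ hy) /= pb_comm.
exists (pb_pair (fun m t => esym (yv m t))).
split=> [m t ht|m t]; last exact: pt_eq.
by apply: pb_eq; rewrite /= ?(xu _ _ ht) ?(yu _ _ ht).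
Qed.

Lemma uncurryl_eq (Z L L' : sSet) (X : bsSet) (w : smap L (ldiv Z X))
    (b : bmap (box Z L') X) n (l : L n) (l' : L' n) m (z : Z m) :
  w n l = curryl b n l' -> uncurryl w m n (z, l) = b m n (z, l').
Proof. by move=> /= ->; rewrite /= sact_id. Qed.

Lemma scomp_id (A B : sSet) (h : smap A B) : scomp h (sid A) = h.
Proof. exact: smap_ext. Qed.

Lemma weq_id (A : sSet) : weq (sid A).
Proof.
move=> K kK; split=> [h h'|h]; first by rewrite !scomp_id.
by exists h; rewrite scomp_id; apply: rst_refl.
Qed.

Section LdivKan.
Variable X : bsSet.
Hypothesis XR : reedy_fibrant X.

Definition bempty (A L : sSet) : bmap (box (sempty A) L) X.
Proof.
apply: (@BMap (box (sempty A) L) X (fun m n z => False_rect _ (svalP z.1))).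
by move=> m m' n n' a c [[]].
Defined.

Lemma ldivl_kan (Z : sSet) (P : ssub Z) : kan_fibration (ldivl (sincl P) X).
Proof.
move=> n k n0; apply/rlpP => u v uv.
have [|//|//|d [dM dP _]] := reedy_box_horn (k := k) XR (@sincl_mono _ P) n0
  (b := uncurryl v) (a := uncurryl u) (c := to_bpt _).
  move=> m q x [l hl] /=; rewrite -(uv _ _ hl) /=.
  by case: x.
exists (curryl d); split=> [m y h|m y].
  apply: bmap_ext => p q [x a]; rewrite [RHS]uncurrylE.
  exact: (dM p q x (sact a (exist _ y h : horn k m))).
apply: bmap_ext => p q [x a]; rewrite [RHS]uncurrylE.
exact: (dP p q x (sact a y)).
Qed.

Lemma ldiv_kan (A : sSet) : kan_complex (ldiv A X).
Proof.
move=> n k n0; apply/rlpP => u v uv.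
have [|//|//|d [dM dP _]] := reedy_box_horn (k := k) XR (@sincl_mono _ (sempty A)) n0
  (b := bempty _ _) (a := uncurryl u) (c := to_bpt _).
  by move=> m q [].
exists (curryl d); split=> [m y h|m y]; last exact: pt_eq.
apply: bmap_ext => p q [x a]; rewrite [RHS]uncurrylE.
exact: (dM p q x (sact a (exist _ y h : horn k m))).
Qed.

Lemma segal_tf (Z : sSet) (P : ssub Z) :
  weq (ldivl (sincl P) X) -> tf (to_bpt X) (@unmarked X Z) P.
Proof.
move=> w L M b _ a c ab ac bc.
have [|d [dM dP]] := kan_weq_rlp (@ldiv_kan Z) (@ldiv_kan P) (@ldivl_kan Z P) w
  (u := curryl a) (v := curryl b).
  by move=> n y h; apply: bmap_ext => p q [x t] /=; apply: ab.
exists (uncurryl d); split=> [m n z [l h]|m n x l|].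
- exact: (uncurryl_eq z (dM _ _ h)).
- exact: (uncurryl_eq (w := scomp (ldivl (sincl P) X) d) x (dP n l)).
- by move=> m n z l; apply: unit_eq.
Qed.

End LdivKan.

Section Lfib.
Variables (X : bsSet) (A : sSet) (s : A 1) (e : X 1 0).

(** By adjunction, this singles out the maps that come from maps [L -> lfib s e]. *)
Definition at_mark (L : sSet) (d : bmap (box A L) X) : Prop :=
  forall n l, d 1 n (s, l) = bact (did 1) (dconst n ord0) e.

Lemma lfib_eq n (t t' : lfib s e n) :
  pb_fst _ _ n t = pb_fst _ _ n t' -> t = t'.
Proof. by move=> h; apply: pb_eq => //; apply: pt_eq. Qed.

Lemma at_markE (L : sSet) (d : bmap (box A L) X) : at_mark d ->
  forall m n (a : dmap m 1) l, d m n (sact a s, l) = bact a (dconst n ord0) e.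
Proof. by move=> h m n a l; rewrite box_natl h -bact_comp dcomp_idl dcomp_idr. Qed.

Lemma lfib_map (L : sSet) (d : bmap (box A L) X) : at_mark d ->
  exists w : smap L (lfib s e), forall n l, pb_fst _ _ n (w n l) = curryl d n l.
Proof.
move=> h.
have hh n l : ldivl (yo s) X n (curryl d n l) = at_edge e n (to_pt L n l).
  by apply: bmap_ext => p q [x y] /=; rewrite at_markE.
by exists (pb_pair hh).
Qed.

Definition lfib_box (L : sSet) (w : smap L (lfib s e)) : bmap (box A L) X :=
  uncurryl (scomp (pb_fst _ _) w).

Lemma lfib_box_mark (L : sSet) (w : smap L (lfib s e)) : at_mark (lfib_box w).
Proof.
move=> n l /=; have := pb_comm (w n l).
move/(congr1 (fun t : ldiv (Delta 1) X n => (t : bmap _ _) 1 n (did 1, did n))) => /=.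
rewrite sact_id => ->.
by congr (bact _ _ e); apply: pt_eq.
Qed.

End Lfib.

Definition cst_edge (X : bsSet) (e : X 1 0) (L : sSet) : bmap (box (Delta 1) L) X.
Proof.
apply: (@BMap (box (Delta 1) L) X
  (fun m n z => bact (z.1 : dmap m 1) (dconst n ord0) e)).
by move=> m m' n n' a c [x l] /=; rewrite -bact_comp dconst_comp.
Defined.

Section LfibKan.
Variables (X Y : bsSet) (f : bmap X Y).
Hypothesis fR : reedy_fibration f.

(** A base change of the gap map of [yo s], along the inclusion of the point [e]. *)
Lemma lfibr_kan (A : sSet) (s : A 1) (e : X 1 0) :
  smono (yo s) -> kan_fibration (lfibr s f e).
Proof.
move=> sI n k n0; apply/rlpP => u v uv.
have [|||d [dM dP df]] := reedy_box_horn (k := k) fR sI n0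
  (b := cst_edge e _) (a := lfib_box u) (c := lfib_box v).
- by move=> m q x l /=; apply: (at_markE (lfib_box_mark u)).
- move=> m q x [l hl]; have /(congr1 (pb_fst _ _ _)) := uv _ _ hl.
  by move/(congr1 (fun t : ldiv A Y q => (t : bmap _ _) m q (x, did q))).
- move=> m q x l; rewrite [RHS](at_markE (lfib_box_mark v)) /=.
  by rewrite bnat.
have dm : at_mark s e d.
  by move=> q l; have := dP 1 q (did 1) l; rewrite /= sact_id.
have [w wE] := lfib_map dm.
exists w; split=> [m y h|m y]; apply: lfib_eq.
  rewrite wE; apply: bmap_ext => p q [x a].
  rewrite [RHS](uncurrylE (scomp (pb_fst _ _) u)).
  exact: (dM p q x (sact a (exist _ y h : horn k m))).
rewrite [LHS](_ : _ = ldivr A f m (pb_fst _ _ m (w m y))) // wE.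
apply: bmap_ext => p q [x a].
rewrite [RHS](uncurrylE (scomp (pb_fst _ _) v)).
exact: (df p q x (sact a y)).
Qed.

End LfibKan.

Lemma lfib_kan_complex (X : bsSet) (A : sSet) (s : A 1) (e : X 1 0) :
  reedy_fibrant X -> smono (yo s) -> kan_complex (lfib s e).
Proof.
move=> XR sI n k n0; apply/rlpP => u v uv.
have [|v' _] := @lfib_map bpt A s tt (Delta n) (to_bpt _); first by [].
have [|w [wu _]] := (rlpP _ _).1 (@lfibr_kan X bpt _ XR A s e sI n k n0) u v'.
  by move=> m y h; apply: lfib_eq; apply: bmap_ext => p q x; apply: unit_eq.
by exists w; split=> // m y; apply: pt_eq.
Qed.

Section CocartTf.
Variables (X Y : bsSet) (f : bmap X Y).
Hypotheses (XR : reedy_fibrant X) (YR : reedy_fibrant Y) (fR : reedy_fibration f).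
Variables (Z : sSet) (P : ssub Z) (s : P 1) (e : X 1 0).
Hypothesis sI : smono (yo (sval s)).
Hypothesis hp : homotopy_pullback (cocart_square (sincl P) s f e).

Lemma edge_mono : smono (yo s).
Proof. by move=> n a b /(congr1 sval) E; apply: sI. Qed.

Let g := lfibr s f e.
Let sidg : scomp g (sid _) = g. Proof. exact: smap_ext. Qed.
Let gap := pb_pair (factor_comm (cocart_square (sincl P) s f e) sidg).

(** Since [g] is a Kan fibration, the identity followed by [g] is an admissible factorization. *)
Lemma gap_weq : weq gap.
Proof.
apply: hp; first by move=> n.
  exact: weq_id.
exact: lfibr_kan edge_mono.
Qed.

(** A base change of the gap map of [sincl P]: as [s] lies in [P], a lift inherits its mark from its
    restriction to [P]. *)
Lemma gap_kan : kan_fibration gap.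
Proof.
move=> n k n0; apply/rlpP => u v uv.
have [|||d [dM dP df]] := reedy_box_horn (k := k) fR (@sincl_mono _ P) n0
  (b := lfib_box (scomp (pb_snd _ _) v)) (a := lfib_box u)
  (c := lfib_box (scomp (pb_fst _ _) v)).
- move=> m q x [l hl]; have /(congr1 (pb_snd _ _ _)) /(congr1 (pb_fst _ _ _)) := uv _ _ hl.
  by move/(congr1 (fun t : ldiv P X q => (t : bmap _ _) m q (x, did q))).
- move=> m q x [l hl]; have /(congr1 (pb_fst _ _ _)) /(congr1 (pb_fst _ _ _)) := uv _ _ hl.
  by move/(congr1 (fun t : ldiv Z Y q => (t : bmap _ _) m q (x, did q))).
- move=> m q x l; have /(congr1 (pb_fst _ _ _)) := pb_comm (v q l).
  by move/(congr1 (fun t : ldiv P Y q => (t : bmap _ _) m q (x, did q))) => /= ->.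
have dm : at_mark (sincl P 1 s) e d.
  by move=> q l; rewrite dP (lfib_box_mark (scomp (pb_snd _ _) v)).
have [w wE] := lfib_map dm.
exists w; split=> [m y h|m y].
  apply: lfib_eq; rewrite wE; apply: bmap_ext => p q [x a].
  rewrite [RHS](uncurrylE (scomp (pb_fst _ _) u)).
  exact: (dM p q x (sact a (exist _ y h : horn k m))).
apply: pb_eq; apply: lfib_eq.
  rewrite [LHS](_ : _ = ldivr Z f m (pb_fst _ _ m (w m y))) // wE.
  apply: bmap_ext => p q [x a].
  rewrite [RHS](uncurrylE (scomp (pb_fst _ _) (scomp (pb_fst _ _) v))).
  exact: (df p q x (sact a y)).
rewrite [LHS](_ : _ = ldivl (sincl P) X m (pb_fst _ _ m (w m y))) // wE.
apply: bmap_ext => p q [x a].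
rewrite [RHS](uncurrylE (scomp (pb_fst _ _) (scomp (pb_snd _ _) v))).
exact: (dP p q x (sact a y)).
Qed.

Lemma cocart_tf : tf f (fun s' e' => s' = sval s /\ e' = e) P.
Proof.
move=> L M b bm a c ab ac bc.
have bmk : at_mark s e b by apply: bm.
have amk : at_mark (sincl P 1 s) e a by move=> n l; rewrite ab bmk.
have cmk : at_mark (sincl P 1 s) (f 1 0 e) c.
  by move=> n l; rewrite -bc bmk bnat.
have [wa waE] := lfib_map amk.
have [wb wbE] := lfib_map bmk.
have [wc wcE] := lfib_map cmk.
have kp : kan_complex (pb (lfibl (sincl P) s (f 1 0 e)) g).
  apply: kan_complex_pb; first exact: lfib_kan_complex.
  exact: lfibr_kan edge_mono.
have bcE n l : lfibl (sincl P) s (f 1 0 e) n (wc n l) = g n (wb n l).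
  apply: lfib_eq.
  rewrite [LHS](_ : _ = ldivl (sincl P) Y n (pb_fst _ _ n (wc n l))) //.
  rewrite [RHS](_ : _ = ldivr P f n (pb_fst _ _ n (wb n l))) // wcE wbE.
  by apply: bmap_ext => p q [x t] /=; rewrite bc.
have [|w [wu wv]] := kan_weq_rlp (lfib_kan_complex (e := e) XR sI) kp gap_kan gap_weq
  (u := wa) (v := pb_pair bcE).
  move=> n l h; apply: pb_eq; apply: lfib_eq.
    rewrite [LHS](_ : _ = ldivr Z f n (pb_fst _ _ n (wa n (exist _ l h)))) //.
    rewrite [RHS](_ : _ = pb_fst _ _ n (wc n l)) // wcE waE.
    by apply: bmap_ext => p q [x t] /=; rewrite ac.
  rewrite [LHS](_ : _ = ldivl (sincl P) X n (pb_fst _ _ n (wa n (exist _ l h)))) //.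
  rewrite [RHS](_ : _ = pb_fst _ _ n (wb n l)) // wbE waE.
  by apply: bmap_ext => p q [x t] /=; rewrite ab.
exists (lfib_box w); split=> [m n z [l h]|m n x l|m n z l].
- have := congr1 (pb_fst _ _ n) (wu n l h); rewrite waE => E.
  exact: (uncurryl_eq (w := scomp (pb_fst _ _) w) z E).
- have := congr1 (pb_fst _ _ n) (congr1 (pb_snd _ _ n) (wv n l)).
  rewrite [RHS](_ : _ = pb_fst _ _ n (wb n l)) // wbE => E.
  exact: (uncurryl_eq
    (w := scomp (pb_fst _ _) (scomp (pb_snd _ _) (scomp gap w))) x E).
- have := congr1 (pb_fst _ _ n) (congr1 (pb_fst _ _ n) (wv n l)).
  rewrite [RHS](_ : _ = pb_fst _ _ n (wc n l)) // wcE => E.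
  exact: (uncurryl_eq
    (w := scomp (pb_fst _ _) (scomp (pb_fst _ _) (scomp gap w))) z E).
Qed.

End CocartTf.

(** * Passage to the zeroth row *)

Lemma tf_rdiv_lift (X Y : bsSet) (f : bmap X Y) (Z : sSet)
    (mk : Z 1 -> X 1 0 -> Prop) (P : ssub Z)
    (u : smap P (rdiv X (Delta 0))) (v : smap Z (rdiv Y (Delta 0))) :
  tf f mk P -> marked mk (sincl P) (uncurryr u) ->
  scomp (rdivl f (Delta 0)) u = scomp v (sincl P) ->
  exists2 w : smap Z (rdiv X (Delta 0)),
    scomp w (sincl P) = u & scomp (rdivl f (Delta 0)) w = v.
Proof.
move=> t um uv.
(* A single vertex is lifted: [L] is Delta^0 and [M] is empty. *)
have a0 : bmap (box Z (sempty (Delta 0))) X.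
  apply: (@BMap (box Z (sempty (Delta 0))) X (fun m n z => False_rect _ (svalP z.2))).
  by move=> m m' n n' a c [z []].
have [||m n x l|d [_ dP df]] := t _ _ _ um a0 (uncurryr v).
- by move=> m n x [].
- by move=> m n x [].
- have := smap_app x uv.
  by move/(congr1 (fun t : rdiv Y (Delta 0) m => (t : bmap _ _) m n (did m, l))).
exists (curryr d); apply: smap_ext => n x; apply: bmap_ext => p q [a l].
  by rewrite [RHS]uncurryrE -dP.
by rewrite [RHS]uncurryrE -df.
Qed.

Section Segal.
Variables (X Y : bsSet) (f : bmap X Y).
Hypotheses (XS : segal_space X) (YS : segal_space Y) (fR : reedy_fibration f).

Lemma segal_spine n : 1 < n -> tf f (@unmarked X (Delta n)) (spine n).
Proof.
move=> n1; apply: tf_total => //; apply: segal_tf.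
- exact: XS.1.
- exact: XS.2.
- exact: YS.1.
- exact: YS.2.
Qed.

Lemma rdiv_inner_fibration : inner_fibration (rdivl f (Delta 0)).
Proof.
move=> n k hk u v uv.
exact: tf_rdiv_lift (tf_inner_horn fR segal_spine hk) _ uv.
Qed.

Lemma segal_cocartesian_qcat (e : X 1 0) : segal_cocartesian f e ->
  qcat_cocartesian (rdivl f (Delta 0)) (byo e : rdiv X (Delta 0) 1).
Proof.
move=> he n u v ue uv.
have h2 : tf f (@mark01 X e 1) (horn (n := 2) ord0).
  apply: (cocart_tf XS.1 YS.1 fR _ he) => m a b.
  move=> /(congr1 (fun c : dmap m 2 => c : 'I_m.+1 -> 'I_3)) E.
  apply: dmap_ext => i; apply: val_inj.
  exact: (congr1 (fun c : 'I_m.+1 -> 'I_3 => val (c i)) E).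
apply: tf_rdiv_lift (tf_outer_horn fR segal_spine h2 (n := n)) _ uv.
move=> [s hs] e' [/= es ->] m l.
rewrite (_ : exist _ s hs = horn01 n); last exact: eq_exist.
by rewrite ue; congr (bact _ _ e); apply: pt_eq.
Qed.

End Segal.

Lemma segal_quasicategory (X : bsSet) :
  segal_space X -> quasicategory (rdiv X (Delta 0)).
Proof.
move=> XS n k hk u v uv.
have sp m : 1 < m -> tf (to_bpt X) (@unmarked X (Delta m)) (spine m).
  by move=> m1; apply: segal_tf; [apply: XS.1|apply: XS.2].
have [//||w wu _] := tf_rdiv_lift (u := u)
    (v := curryr (to_bpt _)) (tf_inner_horn XS.1 sp hk) _ _.
  by apply: smap_ext => m x; apply: bmap_ext => p q z; apply: unit_eq.
by exists w => //; apply: smap_ext => m x; apply: pt_eq.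
Qed.

(* [byo e] is the edge of X / Delta^0 corresponding to the morphism e in X_10. *)
Theorem mainTheorem2 (X Y : bsSet) (f : bmap X Y)
    (hf : segal_cocartesian_fibration f) :
  qcat_cocartesian_fibration (rdivl f (Delta 0)) /\
  (forall e : X 1 0, segal_cocartesian f e ->
     qcat_cocartesian (rdivl f (Delta 0)) (byo e : rdiv X (Delta 0) 1)).
Proof.
case: hf => XS YS fR fC.
have C e : segal_cocartesian f e ->
    qcat_cocartesian (rdivl f (Delta 0)) (byo e : rdiv X (Delta 0) 1).
  exact: segal_cocartesian_qcat.
split=> //; split; try exact: segal_quasicategory.
  exact: rdiv_inner_fibration.
move=> e x px.
(* By Yoneda, a simplex of the zeroth row is determined by its value at the identities. *)
pose e0 := (e : bmap _ _) 1 0 (did 1, did 0).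
pose x0 := (x : bmap _ _) 0 0 (did 0, did 0).
have px0 : f 0 0 x0 = bsource e0.
  move/(congr1 (fun t : rdiv Y (Delta 0) 0 => (t : bmap _ _) 0 0 (did 0, did 0))): px.
  move=> /= ->; rewrite /bsource /e0 -bnat /=.
  by congr (bfun e (_, _)); apply: dmap_ext.
have [e' [e's e'e e'c]] := fC e0 x0 px0.
exists (byo e'); split; last exact: C.
  apply: bmap_ext => p q [a l] /=; rewrite -/(bsource _).
  rewrite (_ : bact _ _ e' = bact a l (bsource e')).
    rewrite e's /x0 -bnat /= ; congr (bfun x (_, _)); exact: dmap_ext.
  by rewrite /bsource -bact_comp; congr (bact _ _ e'); exact: dmap_ext.
apply: bmap_ext => p q [a l] /=; rewrite bnat e'e /e0 -bnat /=.
by congr (bfun e (_, _)); apply: dmap_ext.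
Qed.
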